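(* For every $\eta\in(0,1)$ and every integer $\sigma\ge 2$ there exists a constant $C(\eta,\sigma)>0$ such that for every $N\ge 2$, the iPod process with interaction parameter $\eta$ and $\sigma$ songs on the complete graph $K_N$ (meeting rates $\nu_{i,j}=\frac{1}{N-1}$ for all $i\ne j$), started from any non-trivial initial configuration, has fixation time satisfying $$\mathbb{E}\,T_{\mathrm{fix}}\ge C(\eta,\sigma)\,N.$$
   Context: iPod model. Let $I$ be a set of $N\ge 2$ agents with meeting rates $\nu_{i,j}=\nu_{j,i}\ge 0$ for $i\ne j$, with $\sum_{j\neq i}\nu_{i,j}=1$ for every $i$. Fix $\sigma$ (number of songs) and $\eta\in(0,1)$. At each time $t\ge 0$ each agent $i$ has a probability vector $X_t(i)=(X_t^k(i))_{1\le k\le\sigma}$ on $\{1,\dots,\sigma\}$. To each ordered pair $(i,j)$, $i\neq j$, is attached a Poisson process of rate $\nu_{i,j}$, all independent; its points are meeting times of $i$ and $j$. At a meeting time $t$ of $i$ and $j$, agents $i$ and $j$ independently choose (play) songs $\sigma_i\sim X_{t-}(i)$ and $\sigma_j\sim X_{t-}(j)$; then $X_t^{k}(i)=(1-\eta)X_{t-}^{k}(i)+\eta\,1_{\{k=\sigma_j\}}$ and $X_t^{k}(j)=(1-\eta)X_{t-}^{k}(j)+\eta\,1_{\{k=\sigma_i\}}$ for all $k$, and all other agents are unchanged. Paths are càdlàg. Fixation time: if exactly one song is played infinitely often, $T_{\mathrm{fix}}$ is the last time at which any other song is played ($T_{\mathrm{fix}}=0$ if no other song is ever played); if more than one song is played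 infinitely often, $T_{\mathrm{fix}}=\infty$. Write $M_t^k=\frac1N\sum_{i\in I}X_t^k(i)$. An initial configuration is non-trivial if there is at least one song $k$ with $\frac{1}{2\sigma}\le M_0^k\le 1-\frac{1}{2\sigma}$. *)

(* Defs.v *)
From HB Require Import structures.
From mathcomp Require Import all_boot all_order all_algebra.
From mathcomp Require Import all_classical all_reals all_analysis.

Set Implicit Arguments.
Unset Strict Implicit.
Unset Printing Implicit Defensive.

Import Order.TTheory GRing.Theory Num.Theory.
Import numFieldNormedType.Exports.

Local Open Scope classical_set_scope.
Local Open Scope ring_scope.

Section probability_preliminaries.
Context {R : realType} {d : measure_display} {Omega : measurableType d}
  (P : probability Omega R).

Definition mutually_independent (K : finType) (G : K -> set (set Omega)) :=
  forall (J : {set K}) (A : K -> set Omega), (forall k, k \in J -> G k (A k)) ->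
    P (\bigcap_(k in [set` J]) A k) = (\prod_(k in J) P (A k))%E.

(* A stochastic process is [fun t w => ...]; only times [0 <= t] are relevant. *)

Definition sigma_process (N : R -> Omega -> nat) : set (set Omega) :=
  <<s [set A | exists t (B : set nat), 0 <= t /\ A = N t @^-1` B] >>.

(* Counting process of a Poisson process on (0, +oo): [N t w] is the number of
   points in (0, t]. The second argument of the library's [poisson_prob] is a
   dummy; for a zero parameter, [poisson_prob] is the Dirac mass at 0. *)
Record poisson_process (lambda : R) (N : R -> Omega -> nat) : Prop := {
  poisson_measurable : forall t, 0 <= t -> measurable_fun setT (N t);
  poisson_start : forall w, N 0 w = 0%N;
  poisson_nondecreasing : forall w s t, 0 <= s -> s <= t -> (N s w <= N t w)%N;
  poisson_right_continuous : forall w t, 0 <= t ->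
    \forall s \near t^'+, N s w = N t w;
  poisson_increments : forall s t, 0 <= s -> s <= t -> forall B : set nat,
    P [set w | B (N t w - N s w)%N] = poisson_prob (lambda * (t - s)) 0 B;
  poisson_independent_increments : forall (m : nat) (t : nat -> R),
    0 <= t 0%N -> (forall k, t k <= t k.+1) ->
    mutually_independent (fun k : 'I_m =>
      preimage_set_system setT (fun w => N (t k.+1) w - N (t k) w)%N setT)
}.

End probability_preliminaries.

Notation agent_pair I := {e : I * I | e.1 != e.2}.

Section ipod.
Context {R : realType} {I : finType} {sigma : nat}.

Definition fst_agent (e : agent_pair I) : I := (val e).1.
Definition snd_agent (e : agent_pair I) : I := (val e).2.

Definition meeting_rates (nu : I -> I -> R) : Prop :=
  [/\ forall i j, i != j -> 0 <= nu i j,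
      forall i j, i != j -> nu i j = nu j i &
      forall i, \sum_(j | j != i) nu i j = 1].

(* [x i k] is the probability that agent [i] gives to song [k]. *)
Definition configuration (x : I -> 'I_sigma -> R) : Prop :=
  forall i, (forall k, 0 <= x i k) /\ \sum_k x i k = 1.

Definition mean_song (x : I -> 'I_sigma -> R) (k : 'I_sigma) : R :=
  (\sum_i x i k) / #|I|%:R.

Definition non_trivial (x : I -> 'I_sigma -> R) : Prop :=
  exists k, 1 / (2 * sigma%:R) <= mean_song x k <= 1 - 1 / (2 * sigma%:R).

Definition left_limit (f : R -> R) (t : R) : R := lim (f s @[s --> t^'-]).

Context {d : measure_display} {Omega : measurableType d}.

(* [clock e] counts the meetings attached to the ordered pair [e]; [song e n w]
   is the pair of songs played at the n-th (from 0) of these meetings, by the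
   first and by the second agent of [e] respectively. *)
Implicit Types (clock : agent_pair I -> R -> Omega -> nat)
  (song : agent_pair I -> nat -> Omega -> 'I_sigma * 'I_sigma)
  (X : R -> Omega -> I -> 'I_sigma -> R).

(* Time of the n-th (from 0) meeting of [e]; +oo if there is no such meeting. *)
Definition meeting_time clock (e : agent_pair I) (n : nat) (w : Omega)
    : \bar R :=
  ereal_inf [set t%:E | t in [set t | 0 <= t /\ (n < clock e t w)%N]].

(* What is known just before the songs of the n-th meeting of [e] are chosen:
   all the Poisson processes, and the songs of all the earlier meetings. *)
Definition history clock song (e : agent_pair I) (n : nat) : set (set Omega) :=
  <<s [set A | exists f s (B : set nat), 0 <= s /\ A = clock f s @^-1` B] `|`
      [set A | exists f m ab, A = [set w |
         (meeting_time clock f m w < meeting_time clock e n w)%E /\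
         song f m w = ab]] >>.

(* In [ipod_update], times at which two meetings coincide (a null event) are
   left unconstrained. Since [clock] has finitely many jumps in bounded time,
   [ipod_constant] makes the paths of [X] càdlàg. In [ipod_choice], the songs
   played at a meeting time [t] are conditionally independent given the past,
   with laws the values at [t-] of the two agents. *)
Record ipod_process (P : probability Omega R) (nu : I -> I -> R) (eta : R)
    (x0 : I -> 'I_sigma -> R) clock song X : Prop := {
  ipod_rates : meeting_rates nu;
  ipod_clock : forall e,
    poisson_process P (nu (fst_agent e) (snd_agent e)) (clock e);
  ipod_clock_independent :
    mutually_independent P (fun e => sigma_process (clock e));
  ipod_song_measurable : forall e n ab, measurable (song e n @^-1` [set ab]);
  ipod_measurable : forall t i k, 0 <= t ->
    measurable_fun setT (fun w => X t w i k);
  ipod_configuration : forall t w, 0 <= t -> configuration (X t w);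
  ipod_start : forall w i k, X 0 w i k = x0 i k;
  ipod_constant : forall w i s t, 0 <= s -> s <= t ->
    (forall e n, (s%:E < meeting_time clock e n w <= t%:E)%E ->
       i != fst_agent e /\ i != snd_agent e) ->
    forall k, X t w i k = X s w i k;
  ipod_update : forall w e n t, meeting_time clock e n w = t%:E ->
    (forall f m, meeting_time clock f m w = t%:E -> f = e /\ m = n) ->
    forall k,
      X t w (fst_agent e) k =
        (1 - eta) * left_limit (fun s => X s w (fst_agent e) k) t
        + eta * (k == (song e n w).2)%:R /\
      X t w (snd_agent e) k =
        (1 - eta) * left_limit (fun s => X s w (snd_agent e) k) t
        + eta * (k == (song e n w).1)%:R;
  ipod_choice : forall e n (A : set Omega) (a b : 'I_sigma),
    let met := [set w | (meeting_time clock e n w < +oo)%E] in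
    let before (i : I) (k : 'I_sigma) (w : Omega) :=
      left_limit (fun s => X s w i k) (fine (meeting_time clock e n w)) in
    history clock song e n A ->
    P (A `&` met `&` song e n @^-1` [set (a, b)]) =
      (\int[P]_(w in A `&` met)
         (before (fst_agent e) a w * before (snd_agent e) b w)%:E)%E
}.

Definition played clock song (w : Omega) (k : 'I_sigma) (t : R) : Prop :=
  exists e n, meeting_time clock e n w = t%:E /\
    (k = (song e n w).1 \/ k = (song e n w).2).

Definition infinitely_often clock song (w : Omega) (k : 'I_sigma) : Prop :=
  infinite_set [set t | played clock song w k t].

(* When exactly one song is played infinitely often, the other songs are played
   at finitely many times, and the supremum is a maximum. If no song is played
   infinitely often (a null event), the value is 0. *)
Definition fixation_time clock song (w : Omega) : \bar R :=
  if `[< exists! k, infinitely_often clock song w k >] then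
    ereal_sup ([set 0%E] `|`
      [set t%:E | t in [set t | exists l,
         ~ infinitely_often clock song w l /\ played clock song w l t]])
  else if `[< exists k, infinitely_often clock song w k >] then +oo%E
  else 0%E.

End ipod.

Definition complete_graph_rates {R : realType} (I : finType) (i j : I) : R :=
  1 / (#|I|%:R - 1).

(* Main.v *)
Require Import Defs.
From HB Require Import structures.
From mathcomp Require Import all_boot all_order all_algebra.
From mathcomp Require Import all_classical all_reals all_analysis.
From mathcomp Require Import measurable_realfun.
From mathcomp Require Import ring lra zify.

(** The mean [m] of a song is a martingale that moves by at most [2 / N] at each
meeting, so that [m (1 - m)] keeps at least half of its initial value in
expectation during the first [n = c N^2] meetings, whatever the order in which
the pairs meet. Given this order, an agent with share [z] of the song plays it
at its next meeting with probability [z], independently for distinct agents;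
choosing one agent with [z >= m] and one with [z <= m], the plays after the
[n]-th meeting include both this song and another one with probability at least
[m (1 - m)]. Meetings occur at total rate [N], so by Markov's inequality the
[n]-th one is unlikely to occur before a time of order [N], and two songs played
after time [t] force the fixation time to be at least [t]. *)

Set Implicit Arguments.
Unset Strict Implicit.
Unset Printing Implicit Defensive.

Import Order.TTheory GRing.Theory Num.Theory.
Import numFieldNormedType.Exports.

Local Open Scope classical_set_scope.
Local Open Scope ring_scope.

(** * Songs along a given sequence of meetings *)

(** The order of the meetings can be fixed before any song is drawn because [history] contains every
    clock at all times: conditioning on a clock event, even one about later meetings, leaves the law
    of the next two songs unchanged. Along a fixed order, songs obey the finite sum [expect], which
    involves no probability space. Waiting until every agent plays again has no deterministic bound,
    so only the first [L] meetings are listed, which makes the possible orders finite in number. [L]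
    and the time [T] behind it may depend on [N] in any way, since neither enters the final
    constant. Two obstacles come from the continuous time model. The process is unconstrained at
    coincident meetings, so these are confined to a null set, by subdividing time. And the fixation
    time is bounded below path by path on an explicit measurable event, whose probability is then
    estimated. *)

Lemma fst_neq_snd_agent (I : finType) (e : agent_pair I) :
  fst_agent e != snd_agent e.
Proof. exact: (valP e). Qed.

Section song_chain.
Context {R : realType} {I : finType} {sigma : nat} (eta : R).
Hypothesis eta01 : 0 < eta < 1.
Implicit Types (x : I -> 'I_sigma -> R) (e : agent_pair I)
  (ab : 'I_sigma * 'I_sigma) (p q : seq (agent_pair I))
  (s : seq ('I_sigma * 'I_sigma)) (S : pred 'I_sigma).

Definition meet x e ab : I -> 'I_sigma -> R := fun i k =>
  if i == fst_agent e then (1 - eta) * x i k + eta * (k == ab.2)%:R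
  else if i == snd_agent e then (1 - eta) * x i k + eta * (k == ab.1)%:R
  else x i k.

Fixpoint evolve x p s : I -> 'I_sigma -> R :=
  match p, s with
  | e :: p', ab :: s' => evolve (meet x e ab) p' s'
  | _, _ => x
  end.

(* The expectation of [F] at the songs played along the meetings [p], listed in
   chronological order, when the agents start from [x]. *)
Fixpoint expect x p (F : seq ('I_sigma * 'I_sigma) -> R) : R :=
  if p is e :: p' then
    \sum_ab x (fst_agent e) ab.1 * x (snd_agent e) ab.2 *
      expect (meet x e ab) p' (fun s => F (ab :: s))
  else F [::].

(** Taken over a set of songs so that one estimate covers both the event that only [k] is played and
    the event that [k] is never played. *)
Definition share S (y : 'I_sigma -> R) : R := \sum_(k | S k) y k.

Lemma share_ge0 x S i : configuration x -> 0 <= share S (x i).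
Proof. by move=> cx; apply: sumr_ge0 => k _; exact: (cx i).1. Qed.

Lemma shareC x S i : configuration x ->
  share (predC S) (x i) = 1 - share S (x i).
Proof.
move=> cx; apply/esym/eqP; rewrite subr_eq -(cx i).2 /share addrC.
by rewrite [X in X == _](bigID S)/=.
Qed.

Lemma share_le1 x S i : configuration x -> share S (x i) <= 1.
Proof. by move=> cx; rewrite -subr_ge0 -shareC// share_ge0. Qed.

Lemma share_pred1 k (y : 'I_sigma -> R) : share (pred1 k) y = y k.
Proof. by rewrite /share big_pred1_eq. Qed.

Lemma sum_song (k : 'I_sigma) : \sum_l (l == k)%:R = 1 :> R.
Proof. by rewrite (bigD1 k)//= eqxx big1 ?addr0// => l /negbTE ->. Qed.

Lemma configuration_meet x e ab : configuration x -> configuration (meet x e ab).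
Proof.
have /andP[e0 e1] := eta01.
have H y (k : 'I_sigma) : (forall l, 0 <= y l) /\ \sum_l y l = 1 ->
    (forall l, 0 <= (1 - eta) * y l + eta * (l == k)%:R) /\
    \sum_l ((1 - eta) * y l + eta * (l == k)%:R) = 1.
  move=> [y0 y1]; split => [l|].
    by apply: addr_ge0; apply: mulr_ge0; rewrite ?subr_ge0 ?(ltW e0) ?(ltW e1).
  by rewrite big_split/= -!mulr_sumr y1 sum_song; ring.
move=> cx i; rewrite /meet; case: (i == _); first exact: H.
by case: (i == _); [exact: H|exact: cx].
Qed.

Lemma configuration_evolve x p s :
  configuration x -> configuration (evolve x p s).
Proof.
elim: p x s => [//|e p IH] x [//|ab s] cx /=.
by apply: IH; exact: configuration_meet.
Qed.

Lemma evolve_rcons x p e s ab : size s = size p ->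
  evolve x (rcons p e) (rcons s ab) = meet (evolve x p s) e ab.
Proof.
elim: p x s => [|f p IH] x [|cd s]//= [ss].
exact: IH.
Qed.

Lemma expect_weight x e : configuration x ->
  \sum_ab x (fst_agent e) ab.1 * x (snd_agent e) ab.2 = 1.
Proof.
move=> cx; rewrite -(pair_bigA _ (fun a b => x (fst_agent e) a * x (snd_agent e) b))/=.
rewrite -[RHS](cx (fst_agent e)).2; apply: eq_bigr => a _.
by rewrite -mulr_sumr (cx _).2 mulr1.
Qed.

Lemma expect_weight_ge0 x e ab : configuration x ->
  0 <= x (fst_agent e) ab.1 * x (snd_agent e) ab.2.
Proof. by move=> cx; rewrite mulr_ge0// (cx _).1. Qed.

Lemma expect_le x p F G : configuration x ->
  (forall s, size s = size p -> F s <= G s) -> expect x p F <= expect x p G.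
Proof.
elim: p x F G => [|e p IH] x F G cx FG /=; first exact: FG.
apply: ler_sum => ab _; apply: ler_wpM2l; first exact: expect_weight_ge0.
apply: IH => [|s ss]; first exact: configuration_meet.
by apply: FG; rewrite /= ss.
Qed.

Lemma expectB x p F G :
  expect x p (fun s => F s - G s) = expect x p F - expect x p G.
Proof.
elim: p x F G => [//|e p IH] x F G /=.
rewrite -sumrB; apply: eq_bigr => ab _.
by rewrite (IH _ (fun s => F (ab :: s)) (fun s => G (ab :: s))) mulrBr.
Qed.

Lemma expect_cst x p c : configuration x -> expect x p (fun=> c) = c.
Proof.
elim: p x => [//|e p IH] x cx /=.
under eq_bigr => ab _ do rewrite (IH _ (configuration_meet e ab cx)).
by rewrite -mulr_suml expect_weight// mul1r.
Qed.

Lemma expect_cat x p q F :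
  expect x (p ++ q) F =
  expect x p (fun s => expect (evolve x p s) q (fun s' => F (s ++ s'))).
Proof.
elim: p x F => [//|e p IH] x F /=.
by apply: eq_bigr => ab _; congr (_ * _); rewrite IH.
Qed.

Definition attends (i : I) e := (i == fst_agent e) || (i == snd_agent e).

Definition both S ab := S ab.1 && S ab.2.

Lemma meet_neq x e ab i : ~~ attends i e -> meet x e ab i = x i.
Proof.
by rewrite negb_or => /andP[/negbTE i1 /negbTE i2]; apply/funext=> k; rewrite /meet i1 i2.
Qed.

Lemma sum_both x e S (c : R) :
  \sum_ab x (fst_agent e) ab.1 * x (snd_agent e) ab.2 * ((both S ab)%:R * c) =
  share S (x (fst_agent e)) * share S (x (snd_agent e)) * c.
Proof.
under eq_bigr do rewrite mulrA.
rewrite -mulr_suml; congr (_ * _).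
rewrite -(pair_bigA _ (fun a b =>
  x (fst_agent e) a * x (snd_agent e) b * (both S (a, b))%:R))/=.
rewrite /share mulr_suml [RHS]big_mkcond; apply: eq_bigr => a _ /=.
rewrite mulr_sumr [X in if _ then X else _]big_mkcond/=; case: ifP => Sa; last first.
  by rewrite big1// => b _; rewrite /both/= Sa mulr0.
by apply: eq_bigr => b _; rewrite /both/= Sa; case: (S b); rewrite ?mulr1 ?mulr0.
Qed.

(* An agent that attends a meeting plays a song of [S] at its first one with
   probability [share S (x a)]; the first songs of two distinct agents are
   independent. *)
Lemma expect_all_both x p S a b : configuration x -> a != b ->
  expect x p (fun s => (all (both S) s)%:R) <=
  (if has (attends a) p then share S (x a) else 1) *
  (if has (attends b) p then share S (x b) else 1).
Proof.
move=> cx ab; elim: p x cx => [|e p IH] x cx /=; first by rewrite mulr1.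
(* [B i] bounds the factor of [i] after [e], whatever is played at [e]. If [i] attends [e], its
   first play is paid for at [e] and 1 remains; otherwise its share is unchanged by [e]. *)
pose B (i : I) := if attends i e then 1
  else if has (attends i) p then share S (x i) else 1.
have B01 i : 0 <= B i <= 1.
  rewrite /B; case: ifP => _; first by rewrite ler01 lexx.
  by case: ifP => _; rewrite ?share_ge0 ?share_le1// ler01 lexx.
apply: (@le_trans _ _ (\sum_uv x (fst_agent e) uv.1 * x (snd_agent e) uv.2 *
    ((both S uv)%:R * (B a * B b)))).
  apply: ler_sum => uv _; apply: ler_wpM2l; first exact: expect_weight_ge0.
  case: (both S uv) => /=; last first.
    by rewrite expect_cst ?mul0r//; exact: configuration_meet.
  rewrite mul1r; apply: (le_trans (IH _ _)); first exact: configuration_meet.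
  have cm := configuration_meet e uv cx.
  have HB i : (if has (attends i) p then share S (meet x e uv i) else 1) <= B i.
    rewrite /B; case: (boolP (attends i e)) => ie.
      by case: ifP => // _; exact: share_le1.
    by rewrite meet_neq.
  have H0 i : 0 <= (if has (attends i) p then share S (meet x e uv i) else 1).
    by case: ifP => // _; exact: share_ge0.
  by apply: ler_pM; rewrite ?HB ?H0.
rewrite sum_both.
have /andP[Ba0 Ba1] := B01 a; have /andP[Bb0 Bb1] := B01 b.
have sh i := share_ge0 S i cx; have sh1 i := share_le1 S i cx.
have e12 := fst_neq_snd_agent e.
have L u v (i j : I) : 0 <= u -> 0 <= v -> share S (x i) * share S (x j) * (u * v) <= u * v.
  move=> u0 v0; rewrite ler_piMl ?mulr_ge0// mulr_ile1//.
(* If both attend, [e] joins exactly [a] and [b], as these are distinct. If only one does, the share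
   of its partner is at most 1 and is dropped. *)
case: (boolP (attends a e)) => ae; case: (boolP (attends b e)) => be /=;
  rewrite /B ?ae ?be ?(negbTE ae) ?(negbTE be) /=.
- rewrite mulr1 mulr1.
  move: ae be; rewrite /attends => /orP[] /eqP ea /orP[] /eqP eb; subst.
  + by rewrite eqxx in ab.
  + by [].
  + by rewrite mulrC.
  + by rewrite eqxx in ab.
- rewrite mul1r.
  set t := if _ then _ else _; have t0 : 0 <= t by rewrite /t; case: ifP.
  rewrite ler_wpM2r//.
  move: ae; rewrite /attends => /orP[] /eqP <-; first by rewrite ler_piMr.
  by rewrite ler_piMl.
- rewrite mulr1.
  set t := if _ then _ else _; have t0 : 0 <= t by rewrite /t; case: ifP.
  rewrite mulrC ler_wpM2l//.
  move: be; rewrite /attends => /orP[] /eqP <-; first by rewrite ler_piMr.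
  by rewrite ler_piMl.
- by apply: L; case: ifP.
Qed.

Definition mixed (k : 'I_sigma) s :=
  ~~ all (both (pred1 k)) s && ~~ all (both (predC (pred1 k))) s.

Lemma expect_mixed x p k : configuration x -> (2 <= #|I|)%N ->
  (forall i, has (attends i) p) ->
  mean_song x k * (1 - mean_song x k) <= expect x p (fun s => (mixed k s)%:R).
Proof.
move=> cx I2 hp; set m := mean_song x k.
have I0 : 0 < #|I|%:R :> R by rewrite ltr0n; apply: leq_trans I2.
have /card_gt0P[i0 _] : (0 < #|I|)%N by apply: leq_trans I2.
have sm : \sum_i x i k = #|I|%:R * m by rewrite /m /mean_song mulrCA divff ?mulr1// gt_eqF.
have sm' : \sum_(i : I) m = #|I|%:R * m by rewrite sumr_const mulr_natl.
have [a am] : exists a, m <= x a k.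
  apply: contrapT => H; have : \sum_i x i k < \sum_(i : I) m.
    apply: ltr_sum; first by apply/hasP; exists i0 => //; rewrite mem_index_enum.
    by move=> i _; rewrite ltNge; apply/negP => mi; apply: H; exists i.
  by rewrite sm sm' ltxx.
(* If all other agents exceeded [m], the average would too, since [m <= x a k]. A second agent is
   required for the independence in [expect_all_both]. *)
have [b ba bm] : exists2 b, b != a & x b k <= m.
  apply: contrapT => H; have : \sum_(i | i != a) m < \sum_(i | i != a) x i k.
    apply: ltr_sum.
      apply/hasP; have /card_gt0P[i] : (0 < #|predC1 a|)%N.
        by rewrite cardC1; case: #|I| I2 => [|[|]].
      by exists i => //; rewrite mem_index_enum.
    by move=> i ia; rewrite ltNge; apply/negP => mi; apply: H; exists i.
  rewrite (bigD1 a)//= in sm; rewrite (bigD1 a)//= in sm'; move: sm sm'.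
  set u := \sum_(_ | _) _; set v := \sum_(_ | _) _ => e1 e2 vu.
  by move: e1 e2 vu am; lra.
have e1 := expect_all_both p (pred1 k) cx ba.
have e2 := expect_all_both p (predC (pred1 k)) cx ba.
rewrite !hp !shareC// !share_pred1 in e1 e2.
have xa1 : x a k <= 1 by rewrite -share_pred1 share_le1.
have xb0 := (cx b).1 k.
have : expect x p (fun s => 1 - (all (both (pred1 k)) s)%:R
     - (all (both (predC (pred1 k))) s)%:R) <= expect x p (fun s => (mixed k s)%:R).
  apply: expect_le => // s _; rewrite /mixed.
  by case: all; case: all => /=; lra.
rewrite (expectB x p (fun s => _)) (expectB x p (fun=> 1)) expect_cst//.
apply: le_trans.
(* One minus the two bounds equals [x a k * (1 - x b k) + x b k * (1 - x a k)], whose first product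
   is already at least [m * (1 - m)]. *)
have m1 : m <= 1 by lra.
have m0 : 0 <= m by lra.
nra.
Qed.

(** The increments are regrouped by player instead of listener: each play is compared with the share
    of the agent who plays it, so that each bracket has mean zero. *)
Lemma mean_song_meet x e ab k : mean_song (meet x e ab) k = mean_song x k +
  eta / #|I|%:R * (((k == ab.1)%:R - x (fst_agent e) k) +
                   ((k == ab.2)%:R - x (snd_agent e) k)).
Proof.
have e12 := fst_neq_snd_agent e.
rewrite /mean_song (bigD1 (fst_agent e))//= (bigD1 (snd_agent e)) 1?eq_sym//=.
rewrite [in RHS](bigD1 (fst_agent e))//= [in RHS](bigD1 (snd_agent e)) 1?eq_sym//=.
rewrite (eq_bigr (fun i => x i k)); last first.
  by move=> i /andP[/negbTE i1 /negbTE i2]; rewrite /meet i1 i2.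
rewrite /meet eqxx [snd_agent e == _]eq_sym (negbTE e12) eqxx; ring.
Qed.

(* The mean is a martingale with increments of size at most [2 / N], and
   [m * (1 - m)] only loses the square of the increment. *)
Lemma expect_meet_variance x e k : configuration x ->
  mean_song x k * (1 - mean_song x k) - 4 / #|I|%:R ^+ 2 <=
  \sum_ab x (fst_agent e) ab.1 * x (snd_agent e) ab.2 *
    (mean_song (meet x e ab) k * (1 - mean_song (meet x e ab) k)).
Proof.
move=> cx; set m := mean_song x k.
have I0 : 0 < #|I|%:R :> R.
  by rewrite ltr0n; apply/card_gt0P; exists (fst_agent e).
pose D (ab : 'I_sigma * 'I_sigma) : R := ((k == ab.1)%:R - x (fst_agent e) k) +
                   ((k == ab.2)%:R - x (snd_agent e) k).
have w0 ab : 0 <= x (fst_agent e) ab.1 * x (snd_agent e) ab.2 by apply: expect_weight_ge0.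
have ED : \sum_ab x (fst_agent e) ab.1 * x (snd_agent e) ab.2 * D ab = 0.
  rewrite -(pair_bigA _ (fun a b => x (fst_agent e) a * x (snd_agent e) b * D (a, b)))/=.
  transitivity (\sum_a \sum_b
    (x (fst_agent e) a * ((k == a)%:R - x (fst_agent e) k) * x (snd_agent e) b
     + x (fst_agent e) a * (x (snd_agent e) b * ((k == b)%:R - x (snd_agent e) k)))).
    by apply: eq_bigr => a _; apply: eq_bigr => b _; rewrite /D/=; ring.
  have H i : \sum_b (x i b * ((k == b)%:R - x i k)) = 0.
    under eq_bigr do rewrite mulrBr.
    rewrite sumrB -mulr_suml (cx i).2 mul1r (bigD1 k)//= eqxx mulr1 big1 ?addr0 ?subrr//.
    by move=> b /negbTE; rewrite eq_sym => ->; rewrite mulr0.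
  under eq_bigr do rewrite big_split/= -!mulr_sumr H (cx _).2 mulr0 addr0 mulr1.
  exact: H.
have D2 ab : -2 <= D ab <= 2.
  have xi i : 0 <= x i k <= 1.
    by rewrite (cx i).1 -share_pred1 share_le1.
  have := xi (fst_agent e); have := xi (snd_agent e); rewrite /D.
  have b01 (b : bool) : 0 <= (b%:R : R) <= 1 by case: b; rewrite ?lexx ler01.
  have := b01 (k == ab.1); have := b01 (k == ab.2).
  lra.
pose d := eta / #|I|%:R.
have d0 : 0 <= d by rewrite /d divr_ge0// ltW//; case/andP: eta01.
have dI : d ^+ 2 <= 1 / #|I|%:R ^+ 2.
  rewrite /d expr_div_n ler_pM2r ?invr_gt0 ?exprn_gt0//.
  by rewrite exprn_ile1// ?ltW//; case/andP: eta01.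
apply: (@le_trans _ _ (\sum_ab x (fst_agent e) ab.1 * x (snd_agent e) ab.2 *
    ((m * (1 - m) - 4 / #|I|%:R ^+ 2) + (1 - 2 * m) * d * D ab))).
  under eq_bigr do rewrite mulrDr [X in _ + X]mulrCA.
  by rewrite big_split/= -mulr_suml expect_weight// mul1r -mulr_sumr ED mulr0 addr0.
apply: ler_sum => ab _; apply: ler_wpM2l => //.
rewrite mean_song_meet -/m -/(D ab) -/d.
have : d ^+ 2 * D ab ^+ 2 <= 1 / #|I|%:R ^+ 2 * 4.
  apply: ler_pM; rewrite ?sqr_ge0//.
  by have := D2 ab; nra.
set u := 1 / _; have -> : 4 / #|I|%:R ^+ 2 = u * 4 by rewrite /u; ring.
nra.
Qed.

Lemma expect_variance x p k : configuration x ->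
  mean_song x k * (1 - mean_song x k) - (size p)%:R * (4 / #|I|%:R ^+ 2) <=
  expect x p (fun s => mean_song (evolve x p s) k * (1 - mean_song (evolve x p s) k)).
Proof.
elim: p x => [|e p IH] x cx /=; first by rewrite mul0r subr0.
have := expect_meet_variance e k cx.
set c := 4 / _ => H.
apply: (@le_trans _ _ (\sum_ab x (fst_agent e) ab.1 * x (snd_agent e) ab.2 *
    (mean_song (meet x e ab) k * (1 - mean_song (meet x e ab) k) -
     (size p)%:R * c))); last first.
  apply: ler_sum => ab _; apply: ler_wpM2l; first exact: expect_weight_ge0.
  by apply: IH; exact: configuration_meet.
under eq_bigr do rewrite mulrBr.
rewrite sumrB -mulr_suml expect_weight// mul1r -natr1 mulrDl mul1r.
lra.
Qed.

Lemma expect_late_mixed x p q k : configuration x -> (2 <= #|I|)%N ->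
  (forall i, has (attends i) q) ->
  mean_song x k * (1 - mean_song x k) - (size p)%:R * (4 / #|I|%:R ^+ 2) <=
  expect x (p ++ q) (fun s => (mixed k (drop (size p) s))%:R).
Proof.
move=> cx I2 hq; rewrite expect_cat.
apply: (le_trans (expect_variance p k cx)).
apply: expect_le => // s ss.
apply: (le_trans (expect_mixed k (configuration_evolve p s cx) I2 hq)).
apply: expect_le => [|s' _]; first exact: configuration_evolve.
by rewrite drop_size_cat.
Qed.

End song_chain.

(** * Poisson clocks *)

Section poisson_tails.
Context {R : realType} (r : R).
Hypothesis r0 : 0 < r.

Lemma poisson_prob_set1 n : poisson_prob r 0 [set n] = (poisson_pmf r n)%:E.
Proof. by rewrite /poisson_prob r0 esum_set1// lee_fin poisson_pmf_ge0. Qed.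

Lemma poisson_pmf_series : (\sum_(n <oo) (poisson_pmf r n)%:E = 1)%E.
Proof.
rewrite nneseries_esumT; last by move=> n; rewrite lee_fin poisson_pmf_ge0.
have := @probability_setT _ _ _ (poisson_prob r 0).
rewrite /= /poisson_prob r0 => ->; reflexivity.
Qed.

Lemma poisson_pmf_le1 n : poisson_pmf r n <= 1.
Proof.
by rewrite -lee_fin -poisson_prob_set1 probability_le1.
Qed.

Lemma poisson_pmfS n : n.+1%:R * poisson_pmf r n.+1 = r * poisson_pmf r n.
Proof.
rewrite /poisson_pmf r0 factS natrM exprS invfM.
have : n.+1%:R != 0 :> R by rewrite pnatr_eq0.
set u := n.+1%:R; set v := (n`!%:R)^-1; set c := expR _ => u0.
by field.
Qed.

Lemma poisson_pmfS_le n : poisson_pmf r n.+1 <= r * poisson_pmf r n.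
Proof.
rewrite -poisson_pmfS ler_peMl ?poisson_pmf_ge0//.
by rewrite ler1n.
Qed.

(** The masses from [m] on are compared term by term with [c] times all the masses, which sum to 1.
    The recursion [poisson_pmfS_le] supplies [c = r] and [c = r ^+ 2]. *)
Lemma poisson_prob_ge (m : nat) (c : R) : 0 <= c ->
  (forall n, poisson_pmf r (m + n) <= c * poisson_pmf r n) ->
  (poisson_prob r 0 [set n | (m <= n)%N] <= c%:E)%E.
Proof.
move=> c0 H.
have -> : [set n | (m <= n)%N] = \bigcup_n [set (m + n)%N].
  apply/seteqP; split => [n /= mn|_ [n _ ->]]/=; last exact: leq_addr.
  by exists (n - m)%N => //=; rewrite subnKC.
rewrite measure_semi_bigcup//; last first.
  apply/trivIsetP => i j _ _ ij; apply/seteqP; split => // n [/= -> /addnI /eqP].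
  by rewrite (negbTE ij).
rewrite -[leRHS]mule1 -poisson_pmf_series -nneseriesZl//; last first.
  by move=> n _; rewrite lee_fin poisson_pmf_ge0.
apply: lee_nneseries => n _; first by [].
by rewrite /= poisson_prob_set1 -EFinM lee_fin.
Qed.

Lemma poisson_prob_ge1 : (poisson_prob r 0 [set n | (1 <= n)%N] <= r%:E)%E.
Proof. by apply: poisson_prob_ge => [|n]; [exact: ltW|exact: poisson_pmfS_le]. Qed.

Lemma poisson_prob_ge2 :
  (poisson_prob r 0 [set n | (2 <= n)%N] <= (r ^+ 2)%:E)%E.
Proof.
apply: poisson_prob_ge => [|n]; first by rewrite exprn_ge0// ltW.
apply: (le_trans (poisson_pmfS_le _)).
by rewrite expr2 -mulrA ler_pM2l// poisson_pmfS_le.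
Qed.

(** By [poisson_pmfS], each of the [m.+1] masses is at most [m.+1%:R / r]. This crude decay is
    enough to let [r] tend to infinity. *)
Lemma poisson_prob_le m :
  (poisson_prob r 0 [set n | (n <= m)%N] <= (m.+1%:R ^+ 2 / r)%:E)%E.
Proof.
have : [set n | (n <= m)%N] `<=` \big[setU/set0]_(i < m.+1) [set (i : nat)].
  by move=> n /= nm; rewrite -bigcup_mkord; exists n.
move=> /(content_subadditive (poisson_prob r 0)) H.
apply: (le_trans (H _ _)) => //.
have -> : m.+1%:R ^+ 2 / r = \sum_(i < m.+1) (m.+1%:R / r).
  by rewrite sumr_const card_ord -[RHS]mulr_natl expr2 mulrA.
rewrite -sumEFin; apply: lee_sum => i _.
rewrite /= poisson_prob_set1 lee_fin ler_pdivlMr// mulrC -poisson_pmfS.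
apply: (@le_trans _ _ i.+1%:R); last by rewrite ler_nat.
by rewrite ler_piMr// poisson_pmf_le1.
Qed.

Lemma poisson_mean : (\sum_(n <oo) (n%:R * poisson_pmf r n)%:E = r%:E)%E.
Proof.
rewrite nneseries_recl//; last by move=> n _; rewrite lee_fin mulr_ge0// poisson_pmf_ge0.
rewrite mul0r add0e.
rewrite -nneseries_addn//; last first.
  by move=> n; rewrite lee_fin mulr_ge0// poisson_pmf_ge0.
rewrite -[RHS]mule1 -poisson_pmf_series -nneseriesZl//; last first.
  by move=> n _; rewrite lee_fin poisson_pmf_ge0.
by apply: eq_eseriesr => n _; rewrite addn1 poisson_pmfS EFinM.
Qed.

End poisson_tails.

(** * Real-valued probabilities, null sets and integrals *)

Section finite_probability.
Context {R : realType} {d : measure_display} {T : measurableType d}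
  (P : probability T R).

(** Real-valued, so that estimates are within reach of real arithmetic. *)
Definition pr (A : set T) : R := fine (P A).

Lemma prE A : measurable A -> P A = (pr A)%:E.
Proof. by move=> mA; rewrite /pr fineK// fin_num_measure. Qed.

Lemma pr_ge0 A : 0 <= pr A.
Proof. exact/fine_ge0/measure_ge0. Qed.

Lemma pr_le A B : measurable A -> measurable B -> A `<=` B -> pr A <= pr B.
Proof.
by move=> mA mB AB; rewrite -lee_fin -!prE// le_measure// inE.
Qed.

Lemma pr_setC A : measurable A -> pr (~` A) = 1 - pr A.
Proof.
move=> mA; apply: EFin_inj.
by rewrite -prE ?probability_setC// ?prE//; exact: measurableC.
Qed.

Lemma pr_setU A B : measurable A -> measurable B -> pr (A `|` B) <= pr A + pr B.
Proof.
move=> mA mB; rewrite -lee_fin EFinD -!prE//; last exact: measurableU.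
exact: measureU2.
Qed.

Lemma pr_disjointU A B : measurable A -> measurable B -> A `&` B = set0 ->
  pr (A `|` B) = pr A + pr B.
Proof.
move=> mA mB AB; apply: EFin_inj; rewrite EFinD -!prE//; last exact: measurableU.
by rewrite measureU.
Qed.

Lemma pr_bigsetU (K : eqType) (s : seq K) (F : K -> set T) :
  (forall k, measurable (F k)) ->
  pr (\big[setU/set0]_(k <- s) F k) <= \sum_(k <- s) pr (F k).
Proof.
move=> mF; elim: s => [|k s IH]; first by rewrite !big_nil /pr measure0.
rewrite !big_cons; apply: (le_trans (pr_setU _ _)) => //.
  exact: bigsetU_measurable.
by rewrite lerD2l.
Qed.

Lemma pr_disjoint_bigsetU (K : eqType) (s : seq K) (F : K -> set T) :
  uniq s -> (forall k, measurable (F k)) ->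
  (forall j k w, F j w -> F k w -> j = k) ->
  pr (\big[setU/set0]_(k <- s) F k) = \sum_(k <- s) pr (F k).
Proof.
move=> + mF dF; elim: s => [|k s IH]; first by rewrite !big_nil /pr measure0.
move=> /= /andP[ks us]; rewrite !big_cons pr_disjointU ?IH//.
  exact: bigsetU_measurable.
apply/seteqP; split => // w [Fk].
elim: s ks {us IH} => [|j s IH]; first by rewrite big_nil.
rewrite inE negb_or big_cons => /andP[kj ks] [Fj|]; last exact: IH.
by rewrite (dF _ _ _ Fk Fj) eqxx in kj.
Qed.

Lemma bigsetU_finType (K : finType) (F : K -> set T) :
  \big[setU/set0]_(k : K) F k = \bigcup_k F k.
Proof.
apply/seteqP; split => w.
  by elim/big_rec : _ => // k A _ IH [Fk|/IH//]; exists k.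
by move=> [k _ Fk]; rewrite (bigD1 k)//=; left.
Qed.

Lemma pr_cover (K : finType) (A : set T) (F : K -> set T) :
  measurable A -> (forall k, measurable (F k)) ->
  (forall w, A w -> exists k, F k w) -> pr A <= \sum_k pr (F k).
Proof.
move=> mA mF AF; apply: le_trans (pr_bigsetU _ mF).
apply: pr_le => //; first exact: bigsetU_measurable.
by move=> w /AF[k Fk]; rewrite bigsetU_finType; exists k.
Qed.

Lemma pr_partition (K : finType) (F : K -> set T) :
  (forall k, measurable (F k)) -> (forall j k w, F j w -> F k w -> j = k) ->
  pr (\bigcup_k F k) = \sum_k pr (F k).
Proof.
move=> mF dF; rewrite -bigsetU_finType; apply: pr_disjoint_bigsetU => //.
exact: index_enum_uniq.
Qed.

Lemma null_set (Z : set T) : measurable Z ->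
  (exists c, forall m, pr Z <= c / m.+1%:R) -> P Z = 0%E.
Proof.
move=> mZ [c Hc]; rewrite prE//; congr EFin; apply/eqP.
rewrite eq_le pr_ge0 andbT leNgt; apply/negP => Z0.
have := Hc (Num.trunc (c / pr Z)); rewrite ler_pdivlMr// => H.
have := truncnS_gt (c / pr Z).
by rewrite ltr_pdivrMr// mulrC ltNge H.
Qed.

(* [fixation_time] is not known to be measurable, so that [ge0_le_integral] does
   not apply to it. *)
Lemma integral_ge_event (f : T -> \bar R) (A : set T) (t : R) :
  measurable A -> 0 <= t -> (forall w, (0 <= f w)%E) ->
  (forall w, A w -> (t%:E <= f w)%E) -> ((t * pr A)%:E <= \int[P]_w f w)%E.
Proof.
move=> mA t0 f0 Af; rewrite EFinM -prE//.
rewrite -(integral_cst _ mA) integral_mkcond ge0_integralE; last first.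
  by move=> w _; rewrite patchE; case: ifP => //=; rewrite lee_fin.
(* The integral of a nonnegative function is a supremum over the simple functions below it, hence
   monotone even without measurability. *)
rewrite ge0_integralE//; apply: ereal_sup_le => _ [h hf <-]; exists h => // w.
apply: (le_trans (hf w)).
rewrite !patchE in_setT /=; case: ifPn => [/set_mem /Af//|_]; exact: f0.
Qed.

End finite_probability.

(** Stated for any measurable type because it serves twice: for the events of [Omega] and for the
    sigma-algebra generated by the clocks. *)
Lemma measurable_sum_preimage d (T : measurableType d) (E : finType)
    (f : E -> T -> nat) (B : set nat) :
  (forall e C, measurable (f e @^-1` C)) -> measurable [set w | B (\sum_e f e w)%N].
Proof.
move=> mf.
have H (s : seq E) (C : set nat) : measurable [set w | C (\sum_(e <- s) f e w)%N].
  elim: s C => [|e s IH] C.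
    rewrite (_ : [set _ | _] = if `[< C 0%N >] then setT else set0); last first.
      by apply/seteqP; split=> w /=; rewrite big_nil; case: asboolP.
    by case: ifP.
  rewrite (_ : [set _ | _] = \bigcup_j (f e @^-1` [set j] `&`
     [set w | C (j + \sum_(e <- s) f e w)%N])); last first.
    apply/seteqP; split => w /=; rewrite big_cons; first by exists (f e w).
    by move=> [j _ [/= <-]].
  by apply: bigcup_measurable => j _; apply: measurableI; last exact: (IH (fun n => C (j + n)%N)).
exact: H.
Qed.

(** * Totals and coincidences of independent Poisson processes *)

Section clock_probability.
Context {R : realType} {d : measure_display} {Omega : measurableType d}
  (P : probability Omega R).
Implicit Types (N : R -> Omega -> nat) (s t : R).

Lemma sigma_process_measurable N A :
  (forall t, 0 <= t -> measurable_fun setT (N t)) ->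
  sigma_process N A -> measurable A.
Proof.
move=> mN; apply: smallest_sub; first exact: sigma_algebra_measurable.
by move=> _ [t [B [t0 ->]]]; rewrite -[_ @^-1` _]setTI; exact: mN.
Qed.

Lemma sigma_process_increment N s t (B : set nat) : 0 <= s -> 0 <= t ->
  sigma_process N [set w | B (N t w - N s w)%N].
Proof.
move=> s0 t0.
have E u (C : set nat) : 0 <= u -> @measurable _ (g_sigma_algebraType
    [set A | exists t (B : set nat), 0 <= t /\ A = N t @^-1` B]) (N u @^-1` C).
  by move=> u0; apply: sub_sigma_algebra; exists u, C.
have -> : [set w | B (N t w - N s w)%N] = \bigcup_j
    (N s @^-1` [set j] `&` N t @^-1` [set n | B (n - j)%N]).
  apply/seteqP; split => [w /= Bw|w [j _ [/= <- //]]].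
  by exists (N s w).
exact: (bigcup_measurable (fun j _ => measurableI _ _ (E _ _ s0) (E _ _ t0))).
Qed.

Section one_process.
Variables (lambda : R) (N : R -> Omega -> nat).
Hypotheses (l0 : 0 < lambda) (PN : poisson_process P lambda N).

Lemma poisson_event s t (B : set nat) : 0 <= s -> 0 <= t ->
  measurable [set w | B (N t w - N s w)%N].
Proof.
move=> s0 t0; apply: (@sigma_process_measurable N).
  exact: poisson_measurable PN.
exact: sigma_process_increment.
Qed.

Lemma poisson_value t (B : set nat) : 0 <= t ->
  P (N t @^-1` B) = poisson_prob (lambda * t) 0 B.
Proof.
move=> t0; have := poisson_increments PN (lexx 0) t0 B.
rewrite subr0 => <-; congr (P _); apply/seteqP.
by split => w /=; rewrite (poisson_start PN) subn0.
Qed.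

Lemma poisson_value_measurable t (B : set nat) : 0 <= t ->
  measurable (N t @^-1` B).
Proof.
move=> t0; rewrite -[X in measurable X]setTI.
by apply: (poisson_measurable PN t0). Qed.

Lemma poisson_small t m : 0 < t ->
  pr P [set w | (N t w <= m)%N] <= m.+1%:R ^+ 2 / (lambda * t).
Proof.
move=> t0; rewrite -lee_fin -prE; last first.
  exact: (poisson_value_measurable [set n | (n <= m)%N] (ltW t0)).
rewrite (poisson_value [set n | (n <= m)%N] (ltW t0)).
by apply: poisson_prob_le; exact: mulr_gt0.
Qed.

Lemma poisson_increment_ge1 s t : 0 <= s -> s < t ->
  pr P [set w | (1 <= N t w - N s w)%N] <= lambda * (t - s).
Proof.
move=> s0 st; rewrite -lee_fin -prE; last first.
  exact: (@poisson_event s t (fun n => (1 <= n)%N) s0 (le_trans s0 (ltW st))).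
rewrite (poisson_increments PN s0 (ltW st) (fun n => (1 <= n)%N)).
by apply: poisson_prob_ge1; rewrite mulr_gt0// subr_gt0.
Qed.

Lemma poisson_increment_ge2 s t : 0 <= s -> s < t ->
  pr P [set w | (2 <= N t w - N s w)%N] <= (lambda * (t - s)) ^+ 2.
Proof.
move=> s0 st; rewrite -lee_fin -prE; last first.
  exact: (@poisson_event s t (fun n => (2 <= n)%N) s0 (le_trans s0 (ltW st))).
rewrite (poisson_increments PN s0 (ltW st) (fun n => (2 <= n)%N)).
by apply: poisson_prob_ge2; rewrite mulr_gt0// subr_gt0.
Qed.

Lemma measurable_poisson_value (t : R) : 0 <= t ->
  measurable_fun setT ((fun w => (N t w)%:R%:E) : Omega -> \bar R).
Proof.
move=> t0; apply/measurable_EFinP.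
have mf : measurable_fun [set: nat] (fun n : nat => n%:R : R) by [].
exact: (measurableT_comp mf (poisson_measurable PN t0)).
Qed.

Lemma poisson_expectation t : 0 < t ->
  (\int[P]_w (N t w)%:R%:E = (lambda * t)%:E)%E.
Proof.
move=> t0; have t0' := ltW t0; have lt0 := mulr_gt0 l0 t0.
have ET : [set: Omega] = \bigcup_n (N t @^-1` [set n]).
  by apply/seteqP; split => // w _; exists (N t w).
rewrite [in LHS]ET ge0_integral_bigcup//; first last.
- exact: trivIset_preimage1.
- by rewrite -ET; exact: measurable_poisson_value.
- by move=> n; exact: poisson_value_measurable.
rewrite -(poisson_mean lt0); apply: eq_eseriesr => n _.
have mn := poisson_value_measurable [set n] t0'.
rewrite (eq_integral (cst n%:R%:E)); last by move=> w /set_mem /= ->.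
rewrite integral_cst//=; have -> := poisson_value [set n] t0'.
by rewrite poisson_prob_set1.
Qed.

End one_process.

Section many_processes.
Variables (E : finType) (lambda : E -> R) (N : E -> R -> Omega -> nat).
Hypotheses (l0 : forall e, 0 < lambda e)
  (PN : forall e, poisson_process P (lambda e) (N e))
  (indN : mutually_independent P (fun e => sigma_process (N e))).

Lemma total_value_measurable t (B : set nat) : 0 <= t ->
  measurable [set w | B (\sum_e N e t w)%N].
Proof.
move=> t0; apply: measurable_sum_preimage => e C.
exact: poisson_value_measurable.
Qed.

(** Markov's inequality; the mean of the total comes from linearity, one clock at a time. *)
Lemma total_markov t n : 0 < t ->
  pr P [set w | (n < \sum_e N e t w)%N] <= (\sum_e lambda e) * t / n.+1%:R.
Proof.
move=> t0; have t0' := ltW t0.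
have mA := total_value_measurable [set m | (n < m)%N] t0'.
rewrite ler_pdivlMr// mulrC -lee_fin EFinM -prE// -integral_cst//.
have -> : ((\sum_e lambda e) * t)%:E =
    (\int[P]_w (\sum_(e : E) ((N e t w)%:R : R)%:E))%E.
  rewrite ge0_integral_sum//; last by move=> e; exact: measurable_poisson_value.
  rewrite mulr_suml -sumEFin; apply: eq_bigr => e _.
  by rewrite (poisson_expectation (l0 e) (PN e) t0).
have mS : measurable_fun setT ((fun w => \sum_(e : E) (N e t w)%:R%:E)%E : Omega -> \bar R).
  by apply: emeasurable_sum => e; exact: measurable_poisson_value.
apply: (@le_trans _ _ (\int[P]_(w in [set w | (n < \sum_e N e t w)%N])
    (\sum_(e : E) ((N e t w)%:R : R)%:E))%E).
  apply: ge0_le_integral => //.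
  - by move=> w _; rewrite lee_fin.
  - exact: measurable_funTS.
  - by move=> w /= nw; rewrite sumEFin lee_fin -natr_sum ler_nat.
by apply: ge0_subset_integral => // w _; apply: sume_ge0.
Qed.

(** Observable trace of two coincident meetings inside an interval open at [s] and closed at [t];
    the case [e == f] concerns double points of a single clock. *)
Definition collide e f s t w :=
  if e == f then (2 <= N e t w - N e s w)%N
  else (1 <= N e t w - N e s w)%N && (1 <= N f t w - N f s w)%N.

Lemma collide_measurable e f s t : 0 <= s -> 0 <= t ->
  measurable [set w | collide e f s t w].
Proof.
move=> s0 t0; rewrite /collide; case: eqP => _.
  exact: (@poisson_event _ _ (PN e) s t (fun n => (2 <= n)%N)).
rewrite (_ : [set _ | _] = [set w | (1 <= N e t w - N e s w)%N] `&`
    [set w | (1 <= N f t w - N f s w)%N]); last first.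
  by apply/seteqP; split => w /= => [/andP[]|[-> ->]].
apply: measurableI.
  exact: (@poisson_event _ _ (PN e) s t (fun n => (1 <= n)%N)).
exact: (@poisson_event _ _ (PN f) s t (fun n => (1 <= n)%N)).
Qed.

(** A double point is of second order by the Poisson tail, two points of distinct clocks by
    independence. Being quadratic in the length, the bound vanishes when summed over finer and finer
    subdivisions. *)
Lemma collide_le e f s t : (forall e, lambda e <= 1) -> 0 <= s -> s < t ->
  pr P [set w | collide e f s t w] <= (t - s) ^+ 2.
Proof.
move=> l1 s0 st; have t0 := le_trans s0 (ltW st).
have ts0 : 0 < t - s by rewrite subr_gt0.
have L g : 0 <= lambda g * (t - s) <= t - s.
  by rewrite mulr_ge0 ?(ltW ts0) ?(ltW (l0 g))//= ler_piMl// ltW.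
have [L0 L1] := andP (L e); have [L0' L1'] := andP (L f).
rewrite /collide; case: eqP => [_|/eqP ef].
  apply: (le_trans (poisson_increment_ge2 (l0 e) (PN e) s0 st)).
  by rewrite lerXn2r// nnegrE ltW.
pose A g := [set w | (1 <= N g t w - N g s w)%N].
have mA g : measurable (A g) by apply: (@poisson_event _ _ (PN g) s t (fun n => (1 <= n)%N)).
have := indN (J := [set e; f]%SET) (A := A).
have HA k : k \in [set e; f]%SET -> sigma_process (N k) (A k).
  by move=> _; exact: (@sigma_process_increment _ s t (fun n => (1 <= n)%N)).
move=> /(_ HA); rewrite big_setU1 ?inE//= big_set1 => H.
rewrite (_ : pr P _ = pr P (A e) * pr P (A f)); last first.
  apply: EFin_inj; rewrite EFinM -!prE//; last first.
    by have := collide_measurable e f s0 t0; rewrite /collide (negbTE ef).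
  rewrite -H; congr (P _); apply/seteqP; split => w /=.
    by move=> /andP[we wf] k /=; rewrite !inE => /orP[] /eqP ->.
  by move=> H1; apply/andP; split; apply: H1; rewrite /= !inE eqxx ?orbT.
rewrite expr2; apply: ler_pM; rewrite ?pr_ge0//.
  exact: le_trans (poisson_increment_ge1 (l0 e) (PN e) s0 st) L1.
exact: le_trans (poisson_increment_ge1 (l0 f) (PN f) s0 st) L1'.
Qed.

(* The second part excludes coincident points in [0, T + 1]: no interval of the
   subdivision contains two of them. *)
Definition regular w :=
  (forall e n, exists2 t, 0 <= t & (n < N e t w)%N) /\
  (forall e f T, exists m, forall i, (i < m.+1)%N ->
     ~~ collide e f (i%:R * (T.+1%:R / m.+1%:R))
          (i.+1%:R * (T.+1%:R / m.+1%:R)) w).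

Lemma regular_clocks : (forall e, lambda e <= 1) ->
  exists Z, [/\ measurable Z, P Z = 0%E & forall w, ~ Z w -> regular w].
Proof.
move=> l1.
pose U e n := \bigcap_T [set w | (N e T.+1%:R w <= n)%N].
have mU1 e n (T : nat) : measurable [set w | (N e T.+1%:R w <= n)%N].
  exact: (poisson_value_measurable (PN e) [set k | (k <= n)%N]).
have mU e n : measurable (U e n) by apply: bigcapT_measurable.
have U0 e n : P (U e n) = 0%E.
  apply: null_set => //; exists (n.+1%:R ^+ 2 / lambda e) => T.
  have T0 : 0 < T.+1%:R :> R by [].
  apply: le_trans (le_trans (poisson_small (l0 e) (PN e) n T0) _).
    by apply: pr_le => // w; apply.
  by rewrite invfM mulrA.
(* [V] asks for a collision at every mesh, so each [m] bounds its probability: [m.+1] cells, each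
   contributing at most [(T.+1%:R / m.+1%:R) ^+ 2]. *)
pose V1 e f T m (i : 'I_m.+1) := [set w |
  collide e f (i%:R * (T.+1%:R / m.+1%:R)) (i.+1%:R * (T.+1%:R / m.+1%:R)) w].
pose V e f T := \bigcap_m \bigcup_i V1 e f T m i.
have mV1 e f T m i : measurable (V1 e f T m i).
  by apply: collide_measurable; rewrite mulr_ge0// divr_ge0.
have mV2 e f T m : measurable (\bigcup_i V1 e f T m i).
  by rewrite -bigsetU_finType; exact: bigsetU_measurable.
have mV e f T : measurable (V e f T) by apply: bigcapT_measurable.
have V0 e f T : P (V e f T) = 0%E.
  apply: null_set => //; exists (T.+1%:R ^+ 2) => m.
  apply: (@le_trans _ _ (\sum_(i < m.+1) pr P (V1 e f T m i))).
    by apply: pr_cover => // w /(_ m I)[i _ ?]; exists i.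
  apply: (@le_trans _ _ (\sum_(i < m.+1) (T.+1%:R / m.+1%:R) ^+ 2)).
    apply: ler_sum => i _; apply: (le_trans (collide_le _ _ l1 _ _)).
    - by rewrite mulr_ge0// divr_ge0.
    - by rewrite ltr_pM2r ?divr_gt0// ltr_nat.
    - by rewrite -mulrBl -natrB// subSnn mul1r.
  rewrite sumr_const card_ord -[leLHS]mulr_natl.
  have : m.+1%:R != 0 :> R by rewrite pnatr_eq0.
  set u := m.+1%:R => u0.
  by rewrite le_eqVlt; apply/orP; left; apply/eqP; field.
pose F e := \bigcup_n U e n; pose G e f := \bigcup_T V e f T.
have mF e : measurable (F e) by apply: bigcupT_measurable.
have mG e f : measurable (G e f) by apply: bigcupT_measurable.
have nF e : P.-negligible (F e).
  by apply: negligible_bigcup => n; apply/negligibleP => //; exact: U0.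
have nG e f : P.-negligible (G e f).
  by apply: negligible_bigcup => n; apply/negligibleP => //; exact: V0.
exists (\big[setU/set0]_e F e `|` \big[setU/set0]_(e : E * E) G e.1 e.2).
have m1 : measurable (\big[setU/set0]_e F e) by exact: bigsetU_measurable.
have m2 : measurable (\big[setU/set0]_(e : E * E) G e.1 e.2) by exact: bigsetU_measurable.
split.
- exact: measurableU.
- apply/negligibleP; first exact: measurableU.
  apply: negligibleU.
    by elim/big_rec : _ => [|e A _ IH]; [exact: negligible_set0|exact: negligibleU].
  by elim/big_rec : _ => [|e A _ IH]; [exact: negligible_set0|exact: negligibleU].
- move=> w /not_orP[nFw nGw]; split.
    move=> e n; apply: contrapT => H; apply: nFw; rewrite bigsetU_finType.
    exists e => //; exists n => // T _ /=; rewrite leqNgt; apply/negP => nT.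
    by apply: H; exists T.+1%:R.
  move=> e f T; apply: contrapT => H; apply: nGw; rewrite bigsetU_finType.
  exists (e, f) => //; exists T => // m _ /=.
  apply: contrapT => H1; apply: H; exists m => i im; apply/negP => c.
  by apply: H1; exists (Ordinal im).
Qed.

End many_processes.
End clock_probability.

(** * Order of the meetings *)

Section agent_pairs.
Context {I : finType}.
Implicit Types (e f : agent_pair I) (p : seq (agent_pair I)).

Lemma count_rcons e f p : count_mem f (rcons p e) = (count_mem f p + (e == f))%N.
Proof. by rewrite -cats1 count_cat /= addn0. Qed.

Lemma size_count p : size p = (\sum_e count_mem e p)%N.
Proof.
elim: p => [|e p IH] /=; first by rewrite big1.
by rewrite big_split/= -IH (bigD1 e)//= eqxx big1 // => f; rewrite eq_sym => /negbTE ->.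
Qed.

End agent_pairs.

Section patterns.
Context {R : realType} {I : finType} {d : measure_display}
  {Omega : measurableType d}
  (clock : agent_pair I -> R -> Omega -> nat).
Implicit Types (e f : agent_pair I) (p q : seq (agent_pair I)) (w : Omega).

Local Notation tau := (meeting_time clock).

(* After the meetings [p], the next ones are those of [q], in this order. The
   index of a meeting of [e] is its number of earlier occurrences in the list. *)
Fixpoint pattern p q w : Prop :=
  if q is e :: q' then
    (forall f, tau e (count_mem e p) w < tau f (count_mem f (rcons p e)) w)%E /\
    pattern (rcons p e) q' w
  else True.

Lemma pattern_cat p q q' w :
  pattern p (q ++ q') w <-> pattern p q w /\ pattern (p ++ q) q' w.
Proof.
elim: q p => [|e q IH] p /=; first by rewrite cats0; tauto.
by rewrite IH cat_rcons; tauto.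
Qed.

Lemma pattern_rcons p e w : pattern [::] (rcons p e) w <->
  pattern [::] p w /\
  (forall f, tau e (count_mem e p) w < tau f (count_mem f (rcons p e)) w)%E.
Proof. by rewrite -cats1 pattern_cat /= cats1; tauto. Qed.

(** The meeting at time [t] itself counts as past, in agreement with right-continuous paths: [X t w]
    is the state just after [p]. *)
Definition separates p w (t : R) := [/\ 0 <= t,
  forall f m, (m < count_mem f p)%N -> (tau f m w <= t%:E)%E &
  forall f m, (count_mem f p <= m)%N -> (t%:E < tau f m w)%E].

End patterns.

Section pattern_songs.
Context {I : finType} {sigma : nat} {Omega : Type}
  (song : agent_pair I -> nat -> Omega -> 'I_sigma * 'I_sigma).
Implicit Types (e f : agent_pair I) (p q : seq (agent_pair I)) (w : Omega).

Fixpoint pattern_songs p q w : seq ('I_sigma * 'I_sigma) :=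
  if q is e :: q' then
    song e (count_mem e p) w :: pattern_songs (rcons p e) q' w
  else [::].

Lemma size_pattern_songs p q w : size (pattern_songs p q w) = size q.
Proof. by elim: q p => //= e q IH p; rewrite IH. Qed.

Lemma pattern_songs_cat p q q' w :
  pattern_songs p (q ++ q') w = pattern_songs p q w ++ pattern_songs (p ++ q) q' w.
Proof.
elim: q p => [|e q IH] p /=; first by rewrite cats0.
by rewrite IH cat_rcons.
Qed.

Lemma pattern_songs_rcons p e w : pattern_songs [::] (rcons p e) w =
  rcons (pattern_songs [::] p w) (song e (count_mem e p) w).
Proof. by rewrite -cats1 pattern_songs_cat /= cats1. Qed.

End pattern_songs.

(** * Meeting times and the evolution along a pattern *)

Section meeting_times.
Context {R : realType} {I : finType} {d : measure_display}
  {Omega : measurableType d} (P : probability Omega R)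
  (rate : agent_pair I -> R) (clock : agent_pair I -> R -> Omega -> nat).
Hypothesis Pclock : forall e, poisson_process P (rate e) (clock e).
Implicit Types (e f : agent_pair I) (p q : seq (agent_pair I)) (w : Omega).

Local Notation tau := (meeting_time clock).

(** Right continuity makes the infimum effective: a count of at most [n] at time [t] persists
    slightly beyond [t], which keeps the meeting time strictly above [t]. *)
Lemma meeting_time_le e n w (t : R) : 0 <= t ->
  (tau e n w <= t%:E)%E = (n < clock e t w)%N.
Proof.
move=> t0; apply/idP/idP => [|nt]; last by apply: ereal_inf_lbound; exists t.
apply: contraTT; rewrite -leqNgt -ltNge => tn.
have [s [st ts]] : exists s, clock e s w = clock e t w /\ t < s.
  apply: (@filter_ex _ (nbhs t^'+)); near=> s; split; near: s.
    exact: poisson_right_continuous (Pclock e) w t t0.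
  exact: nbhs_right_gt.
apply: (@lt_le_trans _ _ s%:E); first by rewrite lte_fin.
apply: le_ereal_inf_tmp => _ [u [u0 nu] <-]; rewrite lee_fin leNgt.
apply/negP => us; have := poisson_nondecreasing (Pclock e) w u0 (ltW us).
by rewrite st leqNgt (leq_ltn_trans tn nu).
Unshelve. all: by end_near. Qed.

Lemma meeting_time_gt e n w (t : R) : 0 <= t ->
  (t%:E < tau e n w)%E = (clock e t w <= n)%N.
Proof. by move=> t0; rewrite ltNge meeting_time_le// -leqNgt. Qed.

Lemma meeting_time_gt0 e n w : (0 < tau e n w)%E.
Proof. by rewrite meeting_time_gt// (poisson_start (Pclock e)). Qed.

Lemma meeting_time_homo e w m n : (m <= n)%N -> (tau e m w <= tau e n w)%E.
Proof.
move=> mn; apply: ereal_inf_le_tmp => _ [t [t0 nt] <-]; exists t => //.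
by split => //; exact: leq_ltn_trans nt.
Qed.

Lemma meeting_time_real e n w : (tau e n w < +oo)%E ->
  exists2 t, 0 < t & tau e n w = t%:E.
Proof.
have := meeting_time_gt0 e n w.
by case: (tau e n w) => // t; exists t.
Qed.

Lemma regular_finite e n w : regular clock w -> (tau e n w < +oo)%E.
Proof.
move=> [/(_ e n)[t t0 nt] _]; apply: (@le_lt_trans _ _ t%:E); last exact: ltry.
by rewrite meeting_time_le.
Qed.

Lemma regular_inj e n f m w : regular clock w -> tau e n w = tau f m w ->
  e = f /\ n = m.
Proof.
move=> rw; have [t t0 et] := meeting_time_real (regular_finite e n rw).
rewrite et => ft; have {ft}ft := esym ft.
have [k Hk] := rw.2 e f (Num.trunc t).
set T := (Num.trunc t).+1%:R in Hk; set D := T / k.+1%:R in Hk.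
have tT : t < T by exact: truncnS_gt.
have T0 : 0 < T := lt_trans t0 tT.
have D0 : 0 < D by rewrite divr_gt0.
(* Since [t < T], the least such [i] places [t] in the cell from [i%:R * D], excluded, to
   [i.+1%:R * D], included. Both meetings fall in it, and the absence of a collision makes them
   equal. *)
have ex : exists i, t <= i.+1%:R * D.
  by exists k; rewrite mulrC divfK ?pnatr_eq0// ltW.
case: (ex_minnP ex) => i ti imin.
have ik : (i < k.+1)%N by rewrite ltnS imin// mulrC divfK ?pnatr_eq0// ltW.
have it : i%:R * D < t.
  case: i {ik} ti imin => [|i] ti imin; first by rewrite mul0r.
  by rewrite ltNge; apply/negP => /imin; rewrite ltnn.
have iD0 j : 0 <= j%:R * D by rewrite mulr_ge0// ltW.
have low g j : tau g j w = t%:E -> (clock g (i%:R * D) w <= j)%N.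
  by move=> gt; rewrite -meeting_time_gt// gt lte_fin.
have high g j : tau g j w = t%:E -> (j < clock g (i.+1%:R * D) w)%N.
  by move=> gt; rewrite -meeting_time_le// gt lee_fin.
have := Hk i ik; rewrite /collide.
have := low _ _ et; have := low _ _ ft; have := high _ _ et; have := high _ _ ft.
case: eqP => [<-|_]; last by move=> *; exfalso; lia.
by move=> *; split => //; lia.
Qed.

Lemma separates_rcons p e w t t' : separates clock p w t ->
  (forall f, tau e (count_mem e p) w < tau f (count_mem f (rcons p e)) w)%E ->
  tau e (count_mem e p) w = t'%:E -> t < t' /\ separates clock (rcons p e) w t'.
Proof.
move=> [t0 pt tp] He et.
have tt' : t < t' by rewrite -lte_fin -et tp.
split => //; split; first exact: le_trans (ltW tt').
  move=> f m; rewrite count_rcons; case: (ltnP m (count_mem f p)) => mp.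
    by move=> _; apply: (le_trans (pt _ _ mp)); rewrite lee_fin ltW.
  case: eqP => [<-|_]; last by rewrite addn0 ltnNge mp.
  rewrite addn1 ltnS => mp'; rewrite -et.
  exact: meeting_time_homo.
move=> f m fm; rewrite -et; apply: (lt_le_trans (He f)).
exact: meeting_time_homo.
Qed.

Lemma pattern_separates p w : pattern clock [::] p w -> exists t, separates clock p w t.
Proof.
elim/last_ind: p => [_|p e IH /pattern_rcons[/IH[t st] He]].
  exists 0; split => // f m _; exact: meeting_time_gt0.
(* A time strictly below another one is finite, even if the other is [+oo]. *)
have [t' t0' et] : exists2 t', 0 < t' & tau e (count_mem e p) w = t'%:E.
  by apply: meeting_time_real; apply: (lt_le_trans (He e)); exact: leey.
by exists t'; have [] := separates_rcons st He et.
Qed.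

Lemma separates_count p w t e : separates clock p w t -> count_mem e p = clock e t w.
Proof.
move=> [t0 pt tp]; apply/eqP; rewrite eqn_leq; apply/andP; split; last first.
  by rewrite -meeting_time_gt// tp.
case E: (count_mem e p) => [//|m].
by rewrite -meeting_time_le// pt// E.
Qed.

(** All meetings of [p] precede the next one of [e], so by time [t] they have all occurred, and one
    more. This links counts at a fixed time to positions in the order. *)
Lemma pattern_size_lt p e w t : pattern clock [::] p w -> 0 <= t ->
  (tau e (count_mem e p) w <= t%:E)%E -> (size p < \sum_f clock f t w)%N.
Proof.
move=> /pattern_separates[s sep] t0 et; have [s0 _ sp] := sep.
have st : s <= t by rewrite -lee_fin (le_trans _ et)// ltW// sp.
rewrite size_count (bigD1 e)//= [ltnRHS](bigD1 e)//= -addSn.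
apply: leq_add; first by rewrite -meeting_time_le.
apply: leq_sum => f _; rewrite (separates_count f sep).
exact: (poisson_nondecreasing (Pclock f)).
Qed.

Lemma pattern_exists w n (e0 : agent_pair I) : regular clock w ->
  exists2 p, size p = n & pattern clock [::] p w.
Proof.
move=> rw; elim: n => [|n [p sp pp]]; first by exists [::].
(* The next pair minimizes the next meeting times, strictly by regularity; [e0] only witnesses that
   there is a pair. *)
pose e := [arg min_(f < e0) tau f (count_mem f p) w]%O.
exists (rcons p e); first by rewrite size_rcons sp.
apply/pattern_rcons; split => // f; rewrite lt_neqAle; apply/andP; split.
  apply/eqP => /(regular_inj rw)[<-]; rewrite count_rcons eqxx; lia.
apply: (@le_trans _ _ (tau f (count_mem f p) w)); last first.
  by apply: meeting_time_homo; rewrite count_rcons leq_addr.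
by rewrite /e; case: arg_minP => // g _; apply.
Qed.

(** Two different next pairs would each meet strictly before the other. Hence the patterns of a
    given length are disjoint events, and their probabilities add up. *)
Lemma pattern_unique w p q : size p = size q ->
  pattern clock [::] p w -> pattern clock [::] q w -> p = q.
Proof.
elim/last_ind: p q => [|p e IH] q; first by case: q.
case/lastP: q => [|q f]; first by rewrite size_rcons.
rewrite !size_rcons => -[spq] /pattern_rcons[pp Hp] /pattern_rcons[pq Hq].
have pq' := IH _ spq pp pq; subst q; congr rcons.
apply/eqP; apply: contraT => /negbTE ef.
have := Hp f; have := Hq e; rewrite !count_rcons ef eq_sym ef !addn0 => h1 h2.
by have := lt_trans h1 h2; rewrite ltxx.
Qed.

Section dynamics.
Variables (sigma : nat)
  (song : agent_pair I -> nat -> Omega -> 'I_sigma * 'I_sigma).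
Variables (eta : R) (x0 : I -> 'I_sigma -> R) (X : R -> Omega -> I -> 'I_sigma -> R)
  (nu : I -> I -> R).
Hypothesis ipod : ipod_process P nu eta x0 clock song X.

(** Nothing happens between [t] and the next meeting, and nothing else at that meeting. The former
    gives the left limits, the latter the uniqueness that [ipod_update] requires. *)
Lemma separates_next p e w t f m : separates clock p w t ->
  (forall f, tau e (count_mem e p) w < tau f (count_mem f (rcons p e)) w)%E ->
  (t%:E < tau f m w)%E -> (tau f m w <= tau e (count_mem e p) w)%E ->
  f = e /\ m = count_mem e p.
Proof.
move=> [_ pt tp] He tm me.
have m1 : (count_mem f p <= m)%N.
  by rewrite leqNgt; apply/negP => /pt; rewrite leNgt tm.
have : (m < count_mem f (rcons p e))%N.
  rewrite ltnNge; apply/negP => /(meeting_time_homo f w) H.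
  by have := lt_le_trans (He f) (le_trans H me); rewrite ltxx.
rewrite count_rcons; case: eqP => [ef|_]; last by lia.
by subst f => m2; split => //; lia.
Qed.

Lemma left_limit_pattern p e w t t' i k : separates clock p w t ->
  (forall f, tau e (count_mem e p) w < tau f (count_mem f (rcons p e)) w)%E ->
  tau e (count_mem e p) w = t'%:E ->
  left_limit (fun s => X s w i k) t' = X t w i k.
Proof.
move=> sep He et; have [tt' _] := separates_rcons sep He et.
have [t0 _ _] := sep.
apply: lim_near_cst => //; near=> s.
have ts : t <= s by near: s; exact: nbhs_left_ge.
have st' : s < t' by near: s; exact: nbhs_left_lt.
apply: (ipod_constant ipod) => // f m /andP[tm ms]; exfalso.
have [] : f = e /\ m = count_mem e p.
  apply: (separates_next sep He) => //.
  by rewrite et (le_trans ms)// lee_fin ltW.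
by move=> fe me; move: ms; rewrite fe me et lee_fin leNgt st'.
Unshelve. all: by end_near. Qed.

Lemma update_pattern p e w t t' : separates clock p w t ->
  (forall f, tau e (count_mem e p) w < tau f (count_mem f (rcons p e)) w)%E ->
  tau e (count_mem e p) w = t'%:E ->
  X t' w = meet eta (X t w) e (song e (count_mem e p) w).
Proof.
move=> sep He et; have [tt' _] := separates_rcons sep He et.
have [t0 _ _] := sep.
have uniq_t' f m : tau f m w = t'%:E -> f = e /\ m = count_mem e p.
  by move=> ft; apply: (separates_next sep He); rewrite ?ft ?et ?lte_fin.
apply/funext => i; apply/funext => k; rewrite /meet.
have [U1 U2] := ipod_update ipod et uniq_t' k.
case: eqP => [->|i1]; first by rewrite U1 (left_limit_pattern _ _ sep He et).
case: eqP => [->|i2]; first by rewrite U2 (left_limit_pattern _ _ sep He et).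
apply: (ipod_constant ipod) => //; first exact: ltW.
move=> f m /andP[tm ms].
have [-> _] : f = e /\ m = count_mem e p by apply: (separates_next sep He); rewrite ?et.
by split; apply/eqP.
Qed.

Lemma pattern_state p w : pattern clock [::] p w ->
  exists2 t, separates clock p w t & X t w = evolve eta x0 p (pattern_songs song [::] p w).
Proof.
elim/last_ind: p => [_|p e IH /pattern_rcons[/IH[t st Xt] He]].
  exists 0; first by split => // f m _; exact: meeting_time_gt0.
  by apply/funext => i; apply/funext => k; exact: ipod_start ipod w i k.
have [t' t0' et] : exists2 t', 0 < t' & tau e (count_mem e p) w = t'%:E.
  by apply: meeting_time_real; apply: (lt_le_trans (He e)); exact: leey.
exists t'; first by have [] := separates_rcons st He et.
rewrite (update_pattern st He et) pattern_songs_rcons evolve_rcons ?Xt//.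
exact: size_pattern_songs.
Qed.

Lemma before_pattern p e w i k : pattern clock [::] (rcons p e) w ->
  left_limit (fun s => X s w i k) (fine (tau e (count_mem e p) w)) =
  evolve eta x0 p (pattern_songs song [::] p w) i k.
Proof.
move=> /pattern_rcons[/pattern_state[t st Xt] He].
have [t' t0' et] : exists2 t', 0 < t' & tau e (count_mem e p) w = t'%:E.
  by apply: meeting_time_real; apply: (lt_le_trans (He e)); exact: leey.
by rewrite et /= (left_limit_pattern _ _ st He et) Xt.
Qed.

End dynamics.
End meeting_times.

(** * Law of the songs given the clocks *)

Section songs_given_clocks.
Context {R : realType} {I : finType} {sigma : nat} {d : measure_display}
  {Omega : measurableType d} (P : probability Omega R)
  (nu : I -> I -> R) (eta : R) (x0 : I -> 'I_sigma -> R)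
  (clock : agent_pair I -> R -> Omega -> nat)
  (song : agent_pair I -> nat -> Omega -> 'I_sigma * 'I_sigma)
  (X : R -> Omega -> I -> 'I_sigma -> R).
Hypothesis ipod : ipod_process P nu eta x0 clock song X.
Implicit Types (e f : agent_pair I) (p q : seq (agent_pair I)) (w : Omega)
  (s : seq ('I_sigma * 'I_sigma)) (A C : set Omega).

Local Notation tau := (meeting_time clock).
Local Notation songs := (pattern_songs song).
Let Pclock := ipod_clock ipod.

Definition clock_sets : set (set Omega) :=
  [set A | exists f t (B : set nat), 0 <= t /\ A = clock f t @^-1` B].

(** Contained in every [history], whatever the meeting, by [clock_event_history]; events about the
    future of the clocks are included. *)
Definition clock_event : set (set Omega) :=
  @measurable _ (g_sigma_algebraType clock_sets).

Lemma clock_event_preimage f t (B : set nat) :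
  0 <= t -> clock_event (clock f t @^-1` B).
Proof. by move=> t0; apply: sub_sigma_algebra; exists f, t, B. Qed.

Lemma clock_event_measurable A : clock_event A -> measurable A.
Proof.
apply: smallest_sub; first exact: sigma_algebra_measurable.
move=> _ [f [t [B [t0 ->]]]].
exact: (poisson_value_measurable (Pclock f)).
Qed.

Lemma clock_event_history e n A : clock_event A -> history clock song e n A.
Proof. by apply: sub_sigma_algebra2 => B HB; left. Qed.

(** A rational number between the two meeting times reduces the comparison to counts at that number,
    which has to be nonnegative for these counts to be clock events. *)
Lemma clock_event_lt e n f m :
  clock_event [set w | (tau e n w < tau f m w)%E].
Proof.
rewrite (_ : [set _ | _] = \bigcup_(r : rat)
    if (0 <= ratr r :> R) then clock e (ratr r) @^-1` [set k | (n < k)%N] `&`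
      clock f (ratr r) @^-1` [set k | (k <= m)%N] else set0).
  apply: bigcupT_measurable_rat => r; case: ifP => r0; last exact: measurable0.
  by apply: measurableI; exact: clock_event_preimage.
apply/seteqP; split => w /=; last first.
  move=> [r _]; case: ifP => // r0 [/= h1 h2].
  apply: (@le_lt_trans _ _ (ratr r)%:E).
    by rewrite (meeting_time_le Pclock).
  by rewrite (meeting_time_gt Pclock).
move=> lt_ef; have [t t0 et] : exists2 t, 0 < t & tau e n w = t%:E.
  by apply: (meeting_time_real Pclock); apply: (lt_le_trans lt_ef); exact: leey.
have [u tu uf] : exists2 u, t < u & (u%:E <= tau f m w)%E.
  rewrite et in lt_ef; case: (tau f m w) lt_ef => [u|_|//].
    by rewrite lte_fin => tu; exists u.
  by exists (t + 1); rewrite ?leey// ltrDl.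
have [r] := rat_in_itvoo tu; rewrite in_itv/= => /andP[tr ru].
have r0 : 0 <= ratr r :> R by rewrite ltW// (lt_trans t0).
exists r => //; rewrite r0; split => /=.
  by rewrite -(meeting_time_le Pclock)// et lee_fin ltW.
by rewrite -(meeting_time_gt Pclock)// (lt_le_trans _ uf)// lte_fin.
Qed.

Lemma clock_event_pattern p q : clock_event [set w | pattern clock p q w].
Proof.
elim: q p => [|e q IH] p /=.
  by rewrite (_ : [set _ | _] = setT); [exact: measurableT|apply/seteqP; split].
rewrite (_ : [set _ | _] =
    (\bigcap_f [set w | (tau e (count_mem e p) w < tau f (count_mem f (rcons p e)) w)%E])
    `&` [set w | pattern clock (rcons p e) q w]); last first.
  by apply/seteqP; split => w /= [h1 h2]; split => // f; first move=> _; exact: h1.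
apply: (@measurableI _ (g_sigma_algebraType clock_sets)); last exact: IH.
apply: (@fin_bigcap_measurable _ (g_sigma_algebraType clock_sets)) => [|f _].
  exact: finite_finset.
exact: clock_event_lt.
Qed.

Lemma songs_measurable p q (Q : set (seq ('I_sigma * 'I_sigma))) :
  measurable [set w | Q (songs p q w)].
Proof.
elim: q p Q => [|e q IH] p Q /=.
  rewrite (_ : [set _ | _] = if `[< Q [::] >] then setT else set0); last first.
    by apply/seteqP; split=> w /=; case: asboolP.
  by case: ifP.
rewrite (_ : [set _ | _] = \bigcup_ab (song e (count_mem e p) @^-1` [set ab] `&`
   [set w | Q (ab :: songs (rcons p e) q w)])); last first.
  apply/seteqP; split => w /=; first by exists (song e (count_mem e p) w).
  by move=> [ab _ [/= <-]].
rewrite -bigsetU_finType; apply: bigsetU_measurable => ab _.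
apply: measurableI; first exact: (ipod_song_measurable ipod).
exact: (IH _ (fun s => Q (ab :: s))).
Qed.

(** A [history] records a song only jointly with the fact that its meeting is earlier. On [A] this
    order is guaranteed, so the songs themselves become known. *)
Lemma history_songs e n A p q s : clock_event A ->
  (forall w, A w -> forall f m, (m < count_mem f (p ++ q))%N -> (tau f m w < tau e n w)%E) ->
  history clock song e n (A `&` [set w | songs p q w = s]).
Proof.
move=> cA; elim: q p s => [|f q IH] p s pA /=.
  have H : history clock song e n A by exact: clock_event_history.
  case: s => [|ab s].
    by rewrite (_ : [set _ | _] = setT) ?setIT//; apply/seteqP; split.
  rewrite (_ : [set _ | _] = set0) ?setI0; last by apply/seteqP; split.
  exact: (@measurable0 _ (g_sigma_algebraType _)).
case: s => [|ab s].
  rewrite (_ : [set _ | _] = set0) ?setI0; last by apply/seteqP; split.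
  exact: (@measurable0 _ (g_sigma_algebraType _)).
rewrite (_ : _ `&` _ = (A `&` [set w | songs (rcons p f) q w = s]) `&`
    [set w | (tau f (count_mem f p) w < tau e n w)%E /\ song f (count_mem f p) w = ab]).
  apply: (@measurableI _ (g_sigma_algebraType _)).
    by apply: IH => w Aw; rewrite cat_rcons; exact: pA.
  by apply: sub_sigma_algebra; right; exists f, (count_mem f p), ab.
apply/seteqP; split => w /=; last by move=> [[Aw <-] [_ <-]].
move=> [Aw [<- <-]]; split => //; split => //.
by apply: pA => //; rewrite count_cat /= eqxx; lia.
Qed.

Lemma choice_given_clocks p e s ab C : clock_event C ->
  (forall w, C w -> pattern clock [::] (rcons p e) w) -> size s = size p ->
  pr P (C `&` [set w | songs [::] (rcons p e) w = rcons s ab]) =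
  evolve eta x0 p s (fst_agent e) ab.1 * evolve eta x0 p s (snd_agent e) ab.2 *
  pr P (C `&` [set w | songs [::] p w = s]).
Proof.
move=> cC Cp ss; set n := count_mem e p; set A := C `&` [set w | songs [::] p w = s].
have mA : measurable A.
  apply: measurableI; first exact: clock_event_measurable.
  exact: (songs_measurable _ _ (fun s' => s' = s)).
have hA : history clock song e n A.
  apply: history_songs => // w Cw f m /= mp.
  have /pattern_rcons[pp He] := Cp _ Cw.
  have [t [t0 pt tp]] := pattern_separates Pclock pp.
  by apply: (le_lt_trans (pt _ _ mp)); exact: tp.
(* On [C], the pattern forces the meeting to take place, so the restriction to [met] is void. *)
have Amet : A `&` [set w | (tau e n w < +oo)%E] = A.
  apply/seteqP; split => w; first by case.
  move=> Aw; split => //=; have /Cp /pattern_rcons[_ He] := Aw.1.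
  by apply: (lt_le_trans (He e)); exact: leey.
case: ab => a b; have := ipod_choice ipod a b hA; rewrite Amet /=.
set y := evolve eta x0 p s.
rewrite (eq_integral (cst (y (fst_agent e) a * y (snd_agent e) b)%:E)); last first.
  move=> w /set_mem [Cw /= ws].
  by rewrite !(before_pattern Pclock ipod _ _ (Cp _ Cw)) ws.
rewrite integral_cst//= => H; apply: EFin_inj.
rewrite EFinM -!prE//; last first.
  apply: measurableI; first exact: clock_event_measurable.
  exact: (songs_measurable _ _ (fun s' => s' = _)).
rewrite -H; congr (P _); apply/seteqP; split => w /=.
  rewrite pattern_songs_rcons => -[Cw /rcons_inj[ws wab]].
  by split.
by move=> [[Cw ws] wab]; split => //; rewrite pattern_songs_rcons ws wab.
Qed.

(* On a pattern, the values just before the next meeting are a function of the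
   songs played so far, so that [ipod_choice] integrates a constant. *)
Lemma songs_given_clocks p q s (Q : pred (seq ('I_sigma * 'I_sigma))) C :
  clock_event C -> (forall w, C w -> pattern clock [::] (p ++ q) w) ->
  size s = size p ->
  pr P (C `&` [set w | songs [::] p w = s] `&` [set w | Q (songs p q w)]) =
  expect eta (evolve eta x0 p s) q (fun s' => (Q s')%:R) *
  pr P (C `&` [set w | songs [::] p w = s]).
Proof.
move=> cC; elim: q p s Q => [|e q IH] p s Q Cp ss /=.
  case: (Q [::]); last first.
    rewrite mul0r [X in _ `&` X](_ : _ = set0) ?setI0 ?/pr ?measure0//.
    by apply/seteqP; split.
  by rewrite mul1r [X in _ `&` X](_ : _ = setT) ?setIT//; apply/seteqP; split.
have Cp' w : C w -> pattern clock [::] (rcons p e) w.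
  by move=> /Cp; rewrite -cat_rcons => /pattern_cat[].
pose F ab := C `&` [set w | songs [::] (rcons p e) w = rcons s ab] `&`
  [set w | Q (ab :: songs (rcons p e) q w)].
rewrite (_ : _ `&` _ `&` _ = \bigcup_ab F ab).
  rewrite pr_partition; last 2 first.
  - move=> ab; apply: measurableI; last exact: (songs_measurable _ _ (fun s' => Q (ab :: s'))).
    apply: measurableI; first exact: clock_event_measurable.
    exact: (songs_measurable _ _ (fun s' => s' = _)).
  - move=> ab ab' w [[_ /= e1] _] [[_ /=]].
    by rewrite e1 => /rcons_inj[].
  rewrite mulr_suml; apply: eq_bigr => ab _.
  rewrite (IH _ _ (fun s' => Q (ab :: s')))//; last 2 first.
  - by rewrite cat_rcons.
  - by rewrite !size_rcons ss.
  by rewrite choice_given_clocks// evolve_rcons//; ring.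
apply/seteqP; split => w.
  move=> [[Cw /= ws] Qw]; exists (song e (count_mem e p) w) => //; split => //.
  by split => //=; rewrite pattern_songs_rcons ws.
move=> [ab _ [[Cw /=]]]; rewrite pattern_songs_rcons => /rcons_inj[ws wab] Qw.
by split => //=; rewrite wab.
Qed.

End songs_given_clocks.

(** * Fixation *)

Section fixation.
Context {R : realType} {I : finType} {sigma : nat} {d : measure_display}
  {Omega : measurableType d} (P : probability Omega R)
  (rate : agent_pair I -> R) (clock : agent_pair I -> R -> Omega -> nat)
  (song : agent_pair I -> nat -> Omega -> 'I_sigma * 'I_sigma).
Hypothesis Pclock : forall e, poisson_process P (rate e) (clock e).
Implicit Types (e : agent_pair I) (p q : seq (agent_pair I)) (w : Omega).

(** Excludes the default value 0 of [fixation_time]: the clock of [e] has infinitely many distinct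
    meeting times, shared among finitely many songs. *)
Lemma infinitely_often_exists e w : regular clock w ->
  exists k, infinitely_often clock song w k.
Proof.
move=> rw; apply: contrapT => H.
pose B := \bigcup_(k : 'I_sigma) [set t | played clock song w k t].
have fB : finite_set B.
  apply: bigcup_finite => [|k _]; first exact: finite_finset.
  by apply: contrapT => nk; apply: H; exists k.
pose g n := fine (meeting_time clock e n w).
have gE n : meeting_time clock e n w = (g n)%:E.
  rewrite /g; have [t _ ->] := meeting_time_real Pclock (regular_finite Pclock e n rw).
  by [].
apply: infinite_nat; rewrite (_ : setT = g @^-1` B).
  apply: finite_preimage => // m n _ _ gmn.
  have [] // := @regular_inj _ _ _ _ _ _ _ Pclock e m e n w rw.
  by rewrite !gE gmn.
apply/seteqP; split => // n _; exists (song e n w).1 => //=.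
by exists e, n; split => //; left.
Qed.

(** At most [size p] meetings have occurred by time [t], whereas a meeting of [q] by then would
    bring the total above [size p]. *)
Lemma played_late p q w t ab : regular clock w -> 0 <= t ->
  pattern clock [::] (p ++ q) w -> (\sum_e clock e t w <= size p)%N ->
  ab \in pattern_songs song p q w ->
  exists s, [/\ t < s, played clock song w ab.1 s & played clock song w ab.2 s].
Proof.
move=> rw t0; elim: q p => [//|e q IH] p pq pt /=; rewrite inE => /orP[/eqP ->|].
  have [s s0 es] := meeting_time_real Pclock (regular_finite Pclock e (count_mem e p) rw).
  exists s; split; last 2 first.
  - by exists e, (count_mem e p); split => //; left.
  - by exists e, (count_mem e p); split => //; right.
  rewrite ltNge; apply/negP => st; have /pattern_cat[pp _] := pq.
  have := pattern_size_lt Pclock (e := e) pp t0.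
  by rewrite es lee_fin st => /(_ isT); rewrite ltnNge pt.
apply: IH; first by rewrite cat_rcons.
by rewrite size_rcons (leq_trans pt).
Qed.

(** Both [k] and some [l] other than [k] are played after [t]. Whichever song survives, one of the
    two is not it, and its late play enters the supremum; if several survive, the value is [+oo]. *)
Lemma fixation_time_ge p q w t k : regular clock w -> 0 <= t ->
  pattern clock [::] (p ++ q) w -> (\sum_e clock e t w <= size p)%N ->
  mixed k (pattern_songs song p q w) ->
  (t%:E <= fixation_time clock song w)%E.
Proof.
move=> rw t0 pq pt /andP[/allPn[ab abq Hab] /allPn[cd cdq Hcd]].
have [l lk [s ts ls]] : exists2 l, l != k & exists2 s, t < s & played clock song w l s.
  have [s [ts p1 p2]] := played_late rw t0 pq pt abq.
  move: Hab; rewrite /both negb_and => /orP[] /= H.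
    by exists ab.1 => //; exists s.
  by exists ab.2 => //; exists s.
have [u tu ku] : exists2 u, t < u & played clock song w k u.
  have [u [tu p1 p2]] := played_late rw t0 pq pt cdq.
  move: Hcd; rewrite /both negb_and /= !negbK => /orP[] /eqP <-; exists u => //.
have e : agent_pair I by case: q pq abq cdq {Hab Hcd} => [//|e].
rewrite /fixation_time; case: asboolP => [[h [_ uniq_h]]|_]; last first.
  by case: asboolP => [_|[]]; [exact: leey|exact: infinitely_often_exists].
have [kh|kh] := eqVneq k h.
- apply: (@le_trans _ _ s%:E); first by rewrite lee_fin ltW.
  apply: ereal_sup_ubound; right; exists s => //; exists l; split => //.
  by move=> /uniq_h hl; rewrite kh -hl eqxx in lk.
- apply: (@le_trans _ _ u%:E); first by rewrite lee_fin ltW.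
  apply: ereal_sup_ubound; right; exists u => //; exists k; split => //.
  by move=> /uniq_h hl; rewrite hl eqxx in kh.
Qed.

Lemma fixation_time_ge0 w : (0 <= fixation_time clock song w)%E.
Proof.
rewrite /fixation_time; case: asboolP => _.
  by apply: ereal_sup_ubound; left.
by case: asboolP => _; rewrite ?leey.
Qed.

End fixation.

(** * Late mixing and the lower bound *)

Lemma sum_rates (R : realType) (I : finType) (nu : I -> I -> R) :
  meeting_rates nu -> \sum_(e : agent_pair I) nu (fst_agent e) (snd_agent e) = #|I|%:R.
Proof.
move=> [_ _ nu1].
transitivity (\sum_(e : I * I | e.1 != e.2) nu e.1 e.2).
  exact/esym/(big_sub [pred e : I * I | e.1 != e.2] (fun e => nu e.1 e.2)).
rewrite -(pair_big_dep xpredT (fun i j => i != j) nu)/=.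
under eq_bigr => i _ do under eq_bigl => j do rewrite eq_sym.
by under eq_bigr do rewrite nu1; rewrite sumr_const.
Qed.

Lemma attends_some (I : finType) (i : I) : (2 <= #|I|)%N ->
  exists e : agent_pair I, attends i e.
Proof.
move=> I2; have /card_gt0P[j] : (0 < #|predC1 i|)%N.
  by rewrite cardC1; case: #|I| I2 => [|[|]].
rewrite !inE eq_sym => ij.
by exists (exist _ (i, j) ij); rewrite /attends eqxx.
Qed.

Lemma clock_event_total (R : realType) (I : finType) (d : measure_display)
    (Omega : measurableType d) (clock : agent_pair I -> R -> Omega -> nat)
    (t : R) (B : set nat) : 0 <= t ->
  clock_event clock [set w | B (\sum_e clock e t w)%N].
Proof.
move=> t0; apply: (@measurable_sum_preimage _ (g_sigma_algebraType _)).
by move=> e C; exact: clock_event_preimage.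
Qed.

Section late_mixing.
Context {R : realType} {I : finType} {sigma : nat} {d : measure_display}
  {Omega : measurableType d} (P : probability Omega R)
  (nu : I -> I -> R) (eta : R) (x0 : I -> 'I_sigma -> R)
  (clock : agent_pair I -> R -> Omega -> nat)
  (song : agent_pair I -> nat -> Omega -> 'I_sigma * 'I_sigma)
  (X : R -> Omega -> I -> 'I_sigma -> R).
Hypotheses (eta01 : 0 < eta < 1) (I2 : (2 <= #|I|)%N) (cx0 : configuration x0).
Hypothesis ipod : ipod_process P nu eta x0 clock song X.
Let Pclock := ipod_clock ipod.

Lemma songs_late_mixed (p : seq (agent_pair I)) n k (c : R) C :
  clock_event clock C -> (forall w, C w -> pattern clock [::] p w) ->
  (n <= size p)%N -> (forall e, (n < count_mem e p)%N) ->
  c <= mean_song x0 k * (1 - mean_song x0 k) - n%:R * (4 / #|I|%:R ^+ 2) ->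
  c * pr P C <=
  pr P (C `&` [set w | mixed k (drop n (pattern_songs song [::] p w))]).
Proof.
move=> cC Cp np pn cle.
have := songs_given_clocks ipod (p := [::]) (s := [::])
  (fun s => mixed k (drop n s)) cC Cp (erefl _).
rewrite /= (_ : [set _ | _] = setT) ?setIT; last by apply/seteqP; split.
move=> ->; rewrite ler_wpM2r ?pr_ge0//; apply: (le_trans cle).
have ns : size (take n p) = n by rewrite size_take_min; apply/minn_idPl.
(* More than [n] occurrences of a pair cannot all lie among the first [n] meetings, so every agent
   still meets someone afterwards. *)
have hq i : has (attends i) (drop n p).
  have [e ie] := attends_some i I2.
  apply/hasP; exists e => //; rewrite -has_pred1 has_count.
  have := pn e; rewrite -{1}(cat_take_drop n p) count_cat.
  have := count_size (pred1 e) (take n p); rewrite ns; lia.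
have := expect_late_mixed eta01 (take n p) k cx0 I2 hq.
by rewrite ns cat_take_drop.
Qed.

(* [n] meetings are too few for fixation; the first [L] meetings, which last
   until after [T], comprise more than [n] meetings of each pair, hence late
   ones. *)
Lemma fixation_event (n L : nat) (t T c : R) k :
  (forall e, 0 < nu (fst_agent e) (snd_agent e) <= 1) ->
  0 <= t -> 0 <= T -> (n <= L)%N -> 0 <= c ->
  c <= mean_song x0 k * (1 - mean_song x0 k) - n%:R * (4 / #|I|%:R ^+ 2) ->
  exists A, [/\ measurable A,
    forall w, A w -> (t%:E <= fixation_time clock song w)%E &
    c * (1 - pr P [set w | (n < \sum_e clock e t w)%N]
           - pr P [set w | (L < \sum_e clock e T w)%N]
           - \sum_e pr P [set w | (clock e T w <= n)%N]) <= pr P A].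
Proof.
move=> nu01 t0 T0 nL c0 cle.
have [Z [mZ Z0 HZ]] := regular_clocks (fun e => (andP (nu01 e)).1) Pclock
  (ipod_clock_independent ipod) (fun e => (andP (nu01 e)).2).
pose C1 := [set w | (n < \sum_e clock e t w)%N].
pose C2 := [set w | (L < \sum_e clock e T w)%N].
pose C3 e := [set w | (clock e T w <= n)%N].
have cC1 : clock_event clock C1
  by exact: (@clock_event_total _ _ _ _ clock t (fun m => (n < m)%N)).
have cC2 : clock_event clock C2
  by exact: (@clock_event_total _ _ _ _ clock T (fun m => (L < m)%N)).
have cC3 e : clock_event clock (C3 e)
  by exact: (@clock_event_preimage _ _ _ _ clock e T (fun m => (m <= n)%N)).
pose B := C1 `|` C2 `|` \bigcup_e C3 e.
have cB : clock_event clock B.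
  apply: (@measurableU _ (g_sigma_algebraType _)).
    exact: (@measurableU _ (g_sigma_algebraType _)).
  rewrite -bigsetU_finType.
  by apply: (@bigsetU_measurable _ (g_sigma_algebraType _)) => e _; exact: cC3.
(* Tuples of length [L] form a finite type, so the sum over orders is finite. As [B] is a clock
   event, so is each [C p]. *)
pose C (p : L.-tuple (agent_pair I)) := ~` B `&` [set w | pattern clock [::] p w].
have cC p : clock_event clock (C p).
  apply: (@measurableI _ (g_sigma_algebraType _)).
    exact: (@measurableC _ (g_sigma_algebraType _)).
  exact: (clock_event_pattern ipod).
have mm A := clock_event_measurable ipod (A := A).
pose S (p : L.-tuple (agent_pair I)) :=
  [set w | mixed k (drop n (pattern_songs song [::] p w))].
have mS p : measurable (S p).
  exact: (songs_measurable ipod _ _ (fun s => mixed k (drop n s))).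
have mCS p : measurable (C p `&` S p) by apply: measurableI => //; exact: mm.
have mA1 : measurable (\bigcup_p (C p `&` S p)).
  by rewrite -bigsetU_finType; exact: bigsetU_measurable.
have mA : measurable (\bigcup_p (C p `&` S p) `&` ~` Z).
  by apply: measurableI => //; exact: measurableC.
exists (\bigcup_p (C p `&` S p) `&` ~` Z); split => //.
  move=> w [[p _ [[nB pp] Sp]] nZ].
  have rw := HZ w nZ.
  have np : size (take n p) = n by rewrite size_take_min size_tuple; apply/minn_idPl.
  have := pp; rewrite /= -{1}(cat_take_drop n p) => pp'.
  apply: (fixation_time_ge Pclock (k := k) rw t0 pp').
    by rewrite np leqNgt; apply/negP => H; apply: nB; left; left.
  move: Sp; rewrite /S /= -{1}(cat_take_drop n p) pattern_songs_cat.
  by rewrite drop_size_cat// size_pattern_songs.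
have prZ : pr P Z = 0 by rewrite /pr Z0.
have prA : pr P (\bigcup_p (C p `&` S p)) <= pr P (\bigcup_p (C p `&` S p) `&` ~` Z).
  rewrite -[leRHS]addr0 -prZ; apply: le_trans (pr_setU _ _ _) => //.
  apply: pr_le => //; first exact: measurableU.
  by move=> w Aw; have [|] := pselect (Z w); [right|left].
apply: le_trans prA.
rewrite pr_partition//; last first.
  move=> p q w [[_ /= pp] _] [[_ /= pq] _]; apply: val_inj.
  by apply: (pattern_unique _ pp pq); rewrite !size_tuple.
apply: (@le_trans _ _ (c * \sum_p pr P (C p))); last first.
  rewrite mulr_sumr; apply: ler_sum => p _.
  (* The number of meetings of each pair depends on [p] alone, so it can be read off at any single
     point of [C p]; an empty [C p] contributes nothing. *)
  have [Cp0|/set0P[w [nB pp]]] := eqVneq (C p) set0.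
    by rewrite Cp0 /pr measure0 mulr0 fine_ge0.
  apply: songs_late_mixed => //; first by move=> ? [].
    by rewrite size_tuple.
  move=> e; rewrite ltnNge; apply/negP => en; apply: nB.
  have [He|He] := leqP (clock e T w) n; first by right; exists e.
  left; right; rewrite /C2/= -[X in (X < _)%N](size_tuple p).
  apply: (pattern_size_lt Pclock (e := e) pp T0).
  by rewrite (meeting_time_le Pclock)// (leq_ltn_trans en).
apply: ler_wpM2l => //.
have mB : measurable B by exact: mm.
have prB : pr P B <= pr P C1 + pr P C2 + \sum_e pr P (C3 e).
  apply: (le_trans (pr_setU _ _ _)).
  - by apply: measurableU; exact: mm.
  - by rewrite -bigsetU_finType; apply: bigsetU_measurable => e _; exact: mm.
  apply: lerD.
    by apply: pr_setU; exact: mm.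
  rewrite -bigsetU_finType; apply: pr_bigsetU => e; exact: mm.
have : pr P (~` B) <= \sum_p pr P (C p).
  (* Removing [Z] leaves regular points, at which [pattern_exists] provides an order of length
     [L]. *)
  apply: (@le_trans _ _ (pr P (~` B `&` ~` Z))).
    rewrite -[leRHS]addr0 -prZ; apply: le_trans (pr_setU _ _ _) => //; last first.
      by apply: measurableI; exact: measurableC.
    apply: pr_le; first exact: measurableC.
      by apply: measurableU => //; apply: measurableI; exact: measurableC.
    by move=> w Bw; have [|] := pselect (Z w); [right|left].
  apply: pr_cover => [|p|w [Bw nZ]]; last 1 first.
  - have /card_gt0P[i _] : (0 < #|I|)%N by apply: leq_trans I2.
    have [e0 _] := attends_some i I2.
    have [p sp pp] := pattern_exists Pclock L e0 (HZ w nZ).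
    by move/eqP in sp; exists (Tuple sp); split.
  - by apply: measurableI; exact: measurableC.
  - exact: mm.
rewrite pr_setC//; apply: le_trans.
move: prB; rewrite -/(C1) -/(C2) -/C3; lra.
Qed.

End late_mixing.

Lemma complete_graph_rate_bounds (R : realType) (I : finType) (i j : I) :
  (2 <= #|I|)%N -> 0 < @complete_graph_rates R I i j <= 1.
Proof.
move=> I2; rewrite /complete_graph_rates.
have : 2 <= #|I|%:R :> R by rewrite (ler_nat R 2).
move=> H; have H1 : 0 < #|I|%:R - 1 :> R by lra.
by rewrite divr_gt0//= ler_pdivrMr//; lra.
Qed.

Lemma non_trivial_variance (R : realType) (I : finType) (sigma : nat)
    (x : I -> 'I_sigma -> R) : non_trivial x ->
  exists k, 1 / (2 * sigma%:R) * (1 - 1 / (2 * sigma%:R)) <=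
    mean_song x k * (1 - mean_song x k).
Proof. by move=> [k Hk]; exists k; nra. Qed.

Theorem theorem5p1 (R : realType) (eta : R) (sigma : nat) :
  0 < eta < 1 -> (2 <= sigma)%N ->
  exists C : R, 0 < C /\
    forall (N : nat) (I : finType), (2 <= N)%N -> #|I| = N ->
    forall (d : measure_display) (Omega : measurableType d)
      (P : probability Omega R) (x0 : I -> 'I_sigma -> R)
      (clock : agent_pair I -> R -> Omega -> nat)
      (song : agent_pair I -> nat -> Omega -> 'I_sigma * 'I_sigma)
      (X : R -> Omega -> I -> 'I_sigma -> R),
    configuration x0 -> non_trivial x0 ->
    ipod_process P (@complete_graph_rates R I) eta x0 clock song X ->
    ((C * N%:R)%:E <= \int[P]_w fixation_time clock song w)%E.
Proof.
move=> eta01 s2.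
(* [v] is the value of [m * (1 - m)] at the ends of the interval allowed by non-triviality, hence
   its minimum there. *)
pose v : R := 1 / (2 * sigma%:R) * (1 - 1 / (2 * sigma%:R)).
have v0 : 0 < v.
  have s2R : 2 <= sigma%:R :> R by rewrite (ler_nat R 2).
  have h : 0 < 1 / (2 * sigma%:R) :> R by rewrite divr_gt0//; lra.
  apply: mulr_gt0 => //; rewrite subr_gt0 ltr_pdivrMr; lra.
(* Product of the time [v * N / 32] and the probability [v / 8] obtained below, divided by [N]. *)
exists (v ^+ 2 / 256); split; first by rewrite divr_gt0// exprn_gt0.
move=> N I N2 IN d Omega P x0 clock song X cx0 /non_trivial_variance[k] ipod_v ipod.
subst N; rewrite -/v in ipod_v.
have rates i j := complete_graph_rate_bounds R i j N2.
pose l : R := 1 / (#|I|%:R - 1).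
have /card_gt0P[i0 _] : (0 < #|I|)%N by apply: leq_trans N2.
have [/andP[l0 l1]] : (0 < l <= 1) by exact: (rates i0 i0).
set N : R := #|I|%:R.
have NN : 0 < N by rewrite ltr0n; apply: leq_trans N2.
have sumE : \sum_(e : agent_pair I) @complete_graph_rates R I (fst_agent e) (snd_agent e) = N.
  exact: sum_rates (ipod_rates ipod).
(* With this [n], the total loss [n%:R * (4 / N ^+ 2)] is at most half of [v]. *)
pose n := Num.trunc (v * N ^+ 2 / 8).
have n1 : n%:R <= v * N ^+ 2 / 8.
  by rewrite truncn_le divr_ge0// mulr_ge0 ?(ltW v0)// exprn_ge0// ltW.
have n2 : v * N ^+ 2 / 8 < n.+1%:R by exact: truncnS_gt.
(* The mean number of meetings by time [t] is [N * t], a quarter of [v * N ^+ 2 / 8], hence less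
   than [n.+1%:R / 4]. *)
pose t := v * N / 32.
have t0 : 0 < t by rewrite divr_gt0// mulr_gt0.
pose m : R := n.+1%:R ^+ 2 / l.
have m0 : 0 < m by rewrite divr_gt0// exprn_gt0.
(* By [poisson_small], a given pair meets at most [n] times before [T] with probability at most
   [m / T]; the sum over pairs is at most [1 / 4]. *)
pose T : R := 4 * #|{: agent_pair I}|.+1%:R * m.
have T0 : 0 < T by apply: mulr_gt0 => //; apply: mulr_gt0.
(* The second summand brings Markov's bound at time [T] down to [1 / 4]; the first ensures
   [n <= L]. *)
pose L := (n + Num.trunc (4 * N * T))%N.
have L1 : 4 * N * T <= L.+1%:R.
  apply: ltW; apply: (lt_le_trans (truncnS_gt _)).
  by rewrite ler_nat ltnS leq_addl.
have vle : v / 2 <= mean_song x0 k * (1 - mean_song x0 k) - n%:R * (4 / #|I|%:R ^+ 2).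
  have : n%:R * (4 / N ^+ 2) <= v / 2.
    rewrite mulrA ler_pdivrMr ?exprn_gt0//; lra.
  rewrite -/N; lra.
have v20 : 0 <= v / 2 by lra.
have [A [mA HA prA]] := fixation_event eta01 N2 cx0 ipod
  (fun e => rates (fst_agent e) (snd_agent e)) (ltW t0) (ltW T0)
  (leq_addr _ _ : (n <= L)%N) v20 vle.
have Pcl := ipod_clock ipod.
have rp e : 0 < @complete_graph_rates R I (fst_agent e) (snd_agent e).
  by have /andP[] := rates (fst_agent e) (snd_agent e).
have p1 : pr P [set w | (n < \sum_e clock e t w)%N] <= 1 / 4.
  apply: (le_trans (total_markov rp Pcl n t0)); rewrite sumE.
  rewrite ler_pdivrMr// /t; apply: (@le_trans _ _ (1 / 4 * (v * N ^+ 2 / 8))).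
    by rewrite expr2; lra.
  by rewrite ler_pM2l// ltW.
have p2 : pr P [set w | (L < \sum_e clock e T w)%N] <= 1 / 4.
  apply: (le_trans (total_markov rp Pcl L T0)); rewrite sumE.
  by rewrite ler_pdivrMr//; lra.
have p3 : \sum_e pr P [set w | (clock e T w <= n)%N] <= 1 / 4.
  apply: (@le_trans _ _ (\sum_(e : agent_pair I) (m / T))).
    apply: ler_sum => e _; apply: (le_trans (poisson_small (rp e) (Pcl e) n T0)).
    by rewrite /m /complete_graph_rates -/l invfM mulrA.
  rewrite sumr_const -[leLHS]mulr_natl mulrA ler_pdivrMr// /T.
  have : #|{: agent_pair I}|%:R <= #|{: agent_pair I}|.+1%:R :> R by rewrite ler_nat.
  by nra.
(* The three exceptional probabilities leave at least [1 / 4], multiplied by the remaining variance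
   [v / 2]. *)
have pA : v / 8 <= pr P A by apply: le_trans prA; nra.
apply: le_trans (integral_ge_event P mA (ltW t0) (fixation_time_ge0 clock song) HA).
rewrite lee_fin; apply: (@le_trans _ _ (t * (v / 8))); last by rewrite ler_pM2l.
by rewrite /t -/N; lra.
Qed.
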